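(* Let $m$ be a nonnegative integer and $n$ a positive integer. The number of centered lozenge tilings of a semiregular hexagon with side lengths $2n-1,\,2n-1,\,2m$ equals $Q(m,n)\,P(2n-1,2n-1,2m)$, where $$Q(m,n)=\frac{(2n)!^2\,(2m)!\,(m+2n-1)!}{2\cdot n!^2\,m!\,(2m+4n-2)!}\sum_{i=0}^{n-1}\frac{(-1)^{n-i-1}}{2n-2i-1}\,\frac{(m+n-i)_{2i}}{i!^2}$$ and $$P(a,b,c)=\prod_{i=1}^{a}\prod_{j=1}^{b}\prod_{k=1}^{c}\frac{i+j+k-1}{i+j+k-2}.$$
   Context: Work in the tiling of the plane by unit equilateral triangles. A semiregular hexagon with side lengths $a,b,c$ is a hexagon made of unit triangles, with all angles $120^\circ$ and consecutive sides of lengths $a,b,c,a,b,c$. A lozenge is a rhombus of unit side with angles $60^\circ$ and $120^\circ$, i.e. the union of two unit triangles sharing an edge; a lozenge tiling of a region is a tiling of it by lozenges. $P(a,b,c)$ is the total number of lozenge tilings of the semiregular hexagon with sides $a,b,c$ (MacMahon's product above). For a semiregular hexagon with sides $a,a,b$ where $a$ and $b$ have opposite parity, the center of the hexagon is the center of a unique lozenge of the lattice (the two unit triangles sharing the lattice edge through the center), called the central lozenge; a lozenge tiling is centered if it contains the central lozenge as one of its tiles. The shifted factorial is $(x)_k=x(x+1)\cdots(x+k-1)$ for $k\ge1$, $(x)_0=1$. *)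

(* Defs.v *)
From mathcomp Require Import all_boot all_order all_algebra.

Set Implicit Arguments.
Unset Strict Implicit.
Unset Printing Implicit Defensive.

Import Order.TTheory GRing.Theory Num.Theory.

(* The lattice point (x, y) stands for x *: e1 + y *: e2, where e1, e2 are    *)
(* unit vectors at an angle of 60 degrees; the lattice directions are then    *)
(* e1, e2 and e2 - e1.                                                        *)
Definition point : Type := (nat * nat)%type.

(* The unit triangles inside the parallelogram with sides w *: e1, h *: e2:   *)
(* (x, y, true) has vertices (x, y), (x+1, y), (x, y+1), and (x, y, false) is *)
(* the other half (x+1, y+1), (x+1, y), (x, y+1) of the same unit rhombus.    *)
Notation tri w h := ('I_w * 'I_h * bool)%type.

Definition vertices w h (t : tri w h) : seq point :=
  let: (x, y, up) := t in
  [:: if up then (x : nat, y : nat) else (x.+1, y.+1); (x.+1, y : nat);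
      (x : nat, y.+1)].

(* The hexagon with successive vertices (c, 0), (a+c, 0), (a+c, b), (a, b+c), *)
(* (0, b+c), (0, c), whose successive sides are a *: e1, b *: e2,             *)
(* c *: (e2 - e1) and their opposites. It is allowed to degenerate when one   *)
(* of a, b, c is 0.                                                           *)
Definition in_hexagon (a b c : nat) (p : point) : bool :=
  [&& p.1 <= a + c, p.2 <= b + c & c <= p.1 + p.2 <= a + b + c].

Definition hexagon (a b c : nat) : {set tri (a + c) (b + c)} :=
  [set t | all (in_hexagon a b c) (vertices t)].

Definition shared_vertices w h (t u : tri w h) : seq point :=
  [seq p <- vertices t | p \in vertices u].

(* Sharing exactly two vertices, i.e., sharing an edge, forces t != u.        *)
Definition adjacent w h (t u : tri w h) : bool :=
  size (shared_vertices t u) == 2.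

Definition lozenge w h (L : {set tri w h}) : bool :=
  [exists t, exists u, adjacent t u && (L == [set t; u])].

Definition tiling w h (R : {set tri w h}) (T : {set {set tri w h}}) : bool :=
  partition T R && [forall L in T, lozenge L].

(* The center of a lozenge is the midpoint of the edge shared by its two      *)
(* halves, and that of the hexagon is ((a + c) / 2, (b + c) / 2). Both are    *)
(* doubled here so as to stay in nat.                                         *)
Definition central_lozenge (a b c : nat)
    (L : {set tri (a + c) (b + c)}) : bool :=
  [exists t, exists u, [&& adjacent t u, L == [set t; u],
     \sum_(p <- shared_vertices t u) p.1 == a + c
   & \sum_(p <- shared_vertices t u) p.2 == b + c]].

Definition centered_tilings (a b c : nat) :
    {set {set {set tri (a + c) (b + c)}}} :=
  [set T | tiling (hexagon a b c) T && [exists L in T, central_lozenge L]].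

Local Open Scope ring_scope.

Definition shifted_fact (x : rat) (k : nat) : rat := \prod_(j < k) (x + j%:R).

Definition P (a b c : nat) : rat :=
  \prod_(1 <= i < a.+1) \prod_(1 <= j < b.+1) \prod_(1 <= k < c.+1)
    (((i + j + k)%:R - 1) / ((i + j + k)%:R - 2)).

(* For n > 0 none of the nat subtractions below truncates.                    *)
Definition Q (m n : nat) : rat :=
  (((2 * n)%N`!%:R ^+ 2 * (2 * m)%N`!%:R * (m + 2 * n - 1)%N`!%:R)
     / (2 * n`!%:R ^+ 2 * m`!%:R * (2 * m + 4 * n - 2)%N`!%:R))
  * \sum_(0 <= i < n)
      ((-1) ^+ (n - i - 1)%N / (2 * n - 2 * i - 1)%N%:R
       * (shifted_fact (m + n - i)%N%:R (2 * i)%N / i`!%:R ^+ 2)).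

(* Main.v *)
Require Import Defs.
From mathcomp Require Import all_boot all_order all_algebra.
From mathcomp Require Import fingroup perm zify ring lra.

(* Cut the hexagon along the diagonal through its center that is parallel to  *)
(* the sides 2m. It has N = 2m + 2n - 1 unit edges, and 2n - 1 of them, the   *)
(* set S, are crossed by lozenges; the tiling is centered iff the middle edge *)
(* belongs to S. Either half is a trapezoid with dents, whose tilings are     *)
(* interlacing patterns and hence are counted by det(binomial(s_i, j)), that  *)
(* is by the Vandermonde determinant of S over a product of factorials. The   *)
(* count is therefore a sum of squared Vandermonde determinants over the S    *)
(* that contain the middle, and by Cauchy-Binet it is a difference of two     *)
(* Gram determinants for the uniform weight on N points. In the basis of the  *)
(* monic discrete Chebyshev polynomials p_j, centered at 0 and of squared     *)
(* norms h_j, the Gram matrix is diagonal and the difference equals           *)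
(* (prod_j h_j) * sum_j p_j(0)^2 / h_j. The product, divided by the           *)
(* factorials, is MacMahon's formula, and the sum is Q(m, n), since both      *)
(* satisfy the same recurrence in n when m + n is fixed.                      *)

(** Put a = 2n - 1, c = 2m and N = a + c. In probabilistic terms, the positions S of the lozenges
    astride the middle diagonal of a random tiling form a determinantal ensemble: the probability of
    S is proportional to the square of its Vandermonde determinant. Then Q(m, n) is the density of
    this ensemble at the central point, and P(a, a, c) is its partition function divided by squared
    factorials.

    The squared weight comes from symmetry. The half-turn exchanges the two halves, so both are
    dented trapezoids of the same kind ([card_centered_tilings]). Peeling one strip at a time gives
    chains of interlacing sets, and a binomial determinant summed over interlacing sets is a
    binomial determinant of one size more ([det_binmx_step], [dented_det]). Such a determinant is,
    up to sign and factorials, a Vandermonde determinant, in which any monic polynomials may replace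
    the powers ([norm_det_linear_bin]).

    [Cauchy_Binet] and the rank-one update [det_diag_rank1] then give [sum_cheb_minor]. What remains
    is explicit because the recurrence of the discrete Chebyshev polynomials is: [prod_sqnorm] finds
    MacMahon's product by induction on c, and [pre_S] finds Q, each p_(2n)(0)^2 / h_(2n) being the
    increment of Q from n to n + 1 at fixed m + n, while the odd p_j vanish at 0. *)

Set Implicit Arguments.
Unset Strict Implicit.
Unset Printing Implicit Defensive.

(** * Exact covers of a region cut in two *)

Section ExactCovers.

Variables (T : finType) (tile : pred {set T}).

Definition covers (R : {set T}) : {set {set {set T}}} :=
  [set M | partition M R && [forall L in M, tile L]].

Lemma coversP (R : {set T}) (M : {set {set T}}) :
  reflect [/\ partition M R & {in M, forall L, tile L}] (M \in covers R).
Proof.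
rewrite inE; apply: (iffP andP) => -[pM tM]; split=> //.
  by move=> L LM; apply: (implyP (forallP tM L)).
by apply/forall_inP.
Qed.

Lemma covers0 : #|covers set0| = 1.
Proof.
rewrite -(cards1 (set0 : {set {set T}})); congr #|pred_of_set _|.
apply/setP=> M; rewrite !inE partition_set0; case: eqP => //= ->.
by apply/forall_inP=> L; rewrite inE.
Qed.

(* X is the set of the tiles that are cut by the boundary between A and B.   *)
Section Cut.

Variables (A B : {set T}) (X : {set {set T}}).
Hypothesis disAB : [disjoint A & B].
Hypothesis trivX : trivIset X.
Hypothesis subX : {in X, forall L, [/\ tile L, L \subset A :|: B,
  ~~ (L \subset A) & ~~ (L \subset B)]}.
Hypothesis tileX : forall L, tile L -> L \subset A :|: B ->
  [|| L \subset A, L \subset B | L \in X].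

Let glue (C : {set {set T}}) (p : {set {set T}} * {set {set T}}) :=
  C :|: (p.1 :|: p.2).

Let notA C L : L != set0 -> L \subset B :\: C -> ~~ (L \subset A).
Proof.
move=> /set0Pn[x xL] /subsetP/(_ x xL); rewrite inE => /andP[_ xB].
apply: contraL xB => /subsetP/(_ x xL) xA; by rewrite (disjointFr disAB).
Qed.

Let notB C L : L != set0 -> L \subset A :\: C -> ~~ (L \subset B).
Proof.
move=> /set0Pn[x xL] /subsetP/(_ x xL); rewrite inE => /andP[_ xB].
apply: contraL xB => /subsetP/(_ x xL) xA; by rewrite (disjointFl disAB).
Qed.

Let XF (C : {set {set T}}) L : C \subset X -> L \in C -> (L \subset A = false) * (L \subset B = false).
Proof.
by move=> sC /(subsetP sC)/subX[_ _ /negPf-> /negPf->].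
Qed.

Let glueA (C : {set {set T}}) p : C \subset X ->
  p \in setX (covers (A :\: cover C)) (covers (B :\: cover C)) ->
  [set L in glue C p | L \subset A] = p.1.
Proof.
case: p => q1 q2 sC; rewrite in_setX => /andP[/coversP[p1 _] /coversP[p2 _]].
apply/setP=> L; rewrite !inE /=.
have [LC|_] := boolP (L \in C).
  rewrite (XF sC LC) andbF; apply/esym/negP => L1.
  have := partitionS p1 L1; move/(fun h => subset_trans h (subsetDl _ _)).
  by rewrite (XF sC LC).
have [L1|_] := boolP (L \in q1) => /=.
  exact: subset_trans (partitionS p1 L1) (subsetDl _ _).
apply/negP=> /andP[L2]; apply/negP; apply: notA (partitionS p2 L2).
exact: partition_neq0 p2 L2.
Qed.

Let glueB (C : {set {set T}}) p : C \subset X ->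
  p \in setX (covers (A :\: cover C)) (covers (B :\: cover C)) ->
  [set L in glue C p | L \subset B] = p.2.
Proof.
case: p => q1 q2 sC; rewrite in_setX => /andP[/coversP[p1 _] /coversP[p2 _]].
apply/setP=> L; rewrite !inE /=.
have [LC|_] := boolP (L \in C).
  rewrite (XF sC LC) andbF; apply/esym/negP => L1.
  have := partitionS p2 L1; move/(fun h => subset_trans h (subsetDl _ _)).
  by rewrite (XF sC LC).
rewrite /= orbC; have [L1|_] := boolP (L \in q2) => /=.
  exact: subset_trans (partitionS p2 L1) (subsetDl _ _).
apply/negP=> /andP[L2]; apply/negP; apply: notB (partitionS p1 L2).
exact: partition_neq0 p1 L2.
Qed.

Let coverS (C : {set {set T}}) : C \subset X -> cover C \subset A :|: B.
Proof. by move=> sC; apply/bigcupsP => L /(subsetP sC)/subX[]. Qed.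

Let glue_cover (C : {set {set T}}) p : C \subset X ->
  p \in setX (covers (A :\: cover C)) (covers (B :\: cover C)) ->
  glue C p \in covers (A :|: B) /\ glue C p :&: X = C.
Proof.
case: p => q1 q2 sC; rewrite in_setX => /andP[/coversP[p1 t1] /coversP[p2 t2]]; split.
  apply/coversP; split; last first.
    by move=> L; rewrite !inE => /or3P[/(subsetP sC)/subX[]|/t1|/t2].
  have tC : trivIset C by apply: trivIsetS trivX.
  have ds1 : [disjoint cover q1 & cover q2].
    rewrite (cover_partition p1) (cover_partition p2).
    apply: disjointW disAB; exact: subsetDl.
  have t12 := trivIsetU (partition_trivIset p1) (partition_trivIset p2) ds1.
  rewrite /partition; apply/and3P; split.
  - rewrite /glue /cover !bigcup_setU -!/(cover _).
    rewrite (cover_partition p1) (cover_partition p2) -setDUl.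
    apply/eqP/setP=> x; have := subsetP (coverS sC) x.
    by rewrite !inE; case: (x \in cover C) => //= ->.
  - apply: trivIsetU => //.
    rewrite {2}/cover bigcup_setU -!/(cover _).
    rewrite (cover_partition p1) (cover_partition p2) -setDUl.
    rewrite -setI_eq0; apply/eqP/setP=> x.
    by rewrite !inE; case: (x \in cover C).
  - rewrite !inE !negb_or (partition0 p1) (partition0 p2) !andbT.
    by apply/negP => /(subsetP sC)/subX[_ _]; rewrite sub0set.
apply/setP=> L; rewrite !inE; have [LC|nLC] /= := boolP (L \in C).
  exact: (subsetP sC).
apply/negP=> /andP[/orP[L1|L2] /subX[_ _ /negP nA /negP nB]].
  apply: nA; exact: subset_trans (partitionS p1 L1) (subsetDl _ _).
apply: nB; exact: subset_trans (partitionS p2 L2) (subsetDl _ _).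
Qed.

(** [glue C] is a bijection. Its inverse keeps the tiles contained in [A] and those contained in
    [B]: a tile of [C] is in neither, and a nonempty tile of one side is never contained in the
    other. *)
Lemma card_covers_cut_fiber (C : {set {set T}}) : C \subset X ->
  #|[set M in covers (A :|: B) | M :&: X == C]| =
  #|covers (A :\: cover C)| * #|covers (B :\: cover C)|.
Proof.
move=> sC; rewrite -cardsX -(card_in_imset (f := glue C)); last first.
  move=> p q hp hq /[dup] e1 e2.
  have := glueA sC hp; rewrite e1 glueA // => e3.
  have := glueB sC hp; rewrite e1 glueB // => e4.
  by rewrite [p]surjective_pairing [q]surjective_pairing e3 e4.
congr #|pred_of_set _|; apply/setP=> M; apply/idP/imsetP; last first.
  by case=> p hp ->; have [h1 h2] := glue_cover sC hp; rewrite inE h1 h2 eqxx.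
rewrite inE => /andP[/coversP[pM tM] /eqP eC].
have CM : C \subset M by rewrite -eC subsetIl.
have split3 L : L \in M -> [|| L \subset A, L \subset B | L \in C].
  move=> LM; have := tileX (tM L LM) (partitionS pM LM).
  by rewrite -eC inE LM.
have half D D' : D :|: D' = A :|: B -> [disjoint D & D'] ->
    (forall L, L \in M -> [|| L \subset D, L \subset D' | L \in C]) ->
    (forall L, L \in C -> ~~ (L \subset D)) ->
    [set L in M | L \subset D] \in covers (D :\: cover C).
  move=> eD dD sp nD; apply/coversP; split; last first.
    by move=> L; rewrite inE => /andP[/tM].
  apply/and3P; split.
  - apply/eqP/setP=> x; apply/bigcupP/idP.
      case=> L; rewrite inE => /andP[LM LD] xL.
      rewrite inE (subsetP LD _ xL) andbT; apply/bigcupP=> -[L' L'C xL'].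
      have := L'C; apply/negP; apply: contraL LD => L'C'.
      have <- // : L' = L; last exact: nD.
      have tr := partition_trivIset pM.
      rewrite -(def_pblock tr LM xL).
      by rewrite (def_pblock tr (subsetP CM _ L'C) xL').
    rewrite inE => /andP[xC xD].
    have xM : x \in cover M.
      by rewrite (cover_partition pM) -eD inE xD.
    case/bigcupP: xM => L LM xL; exists L => //.
    rewrite inE LM; case/or3P: (sp L LM) => // [LD'|LC].
      by have := subsetP LD' _ xL; rewrite (disjointFr dD xD).
    by case/negP: xC; apply/bigcupP; exists L.
  - apply: trivIsetS (partition_trivIset pM).
    by apply/subsetP=> L; rewrite inE => /andP[].
  - by rewrite inE (partition0 pM).
have hA : [set L in M | L \subset A] \in covers (A :\: cover C).
  apply: (half A B) => // L LC; by rewrite (XF sC LC).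
have hB : [set L in M | L \subset B] \in covers (B :\: cover C).
  apply: (half B A); rewrite ?[B :|: A]setUC // 1?disjoint_sym // => L.
    by move/split3 => /or3P[]->; rewrite ?orbT.
  by move=> LC; rewrite (XF sC LC).
exists ([set L in M | L \subset A], [set L in M | L \subset B]).
  by rewrite in_setX hA.
apply/setP=> L; rewrite !inE /=.
have [LM|nLM] := boolP (L \in M); last by rewrite orbF; apply/esym/negP=> /(subsetP CM); apply/negP.
by move: (split3 L LM) => /or3P[]->; rewrite ?orbT.
Qed.

(** The predicate [Z] sees only the cut tiles; it will express that the central lozenge, which is
    one of them, is used. *)
Lemma card_covers_cut (Z : pred {set {set T}}) :
  #|[set M in covers (A :|: B) | Z (M :&: X)]| =
  \sum_(C in powerset X | Z C)
    #|covers (A :\: cover C)| * #|covers (B :\: cover C)|.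
Proof.
rewrite -sum1_card.
rewrite (partition_big (fun M => M :&: X) (fun C => (C \in powerset X) && Z C)).
  apply: eq_bigr => C /andP[sC ZC]; rewrite -card_covers_cut_fiber -?powersetE //.
  rewrite -sum1_card; apply: eq_bigl => M; rewrite !inE.
  by have [->|] := eqVneq (M :&: X) C; rewrite ?andbF ?ZC ?andbT.
by move=> M; rewrite inE powersetE subsetIr => /andP[].
Qed.

Lemma card_covers_sum :
  #|covers (A :|: B)| =
  \sum_(C in powerset X) #|covers (A :\: cover C)| * #|covers (B :\: cover C)|.
Proof.
have := card_covers_cut predT; rewrite (eq_bigl (mem (powerset X))) => [<-|C].
  by apply: eq_card => M; rewrite [RHS]inE andbT.
by rewrite andbT.
Qed.

End Cut.
End ExactCovers.

(** * Perfect matchings of a path *)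

Section Interlacing.

(* [pairable s] decides whether the path graph from which the vertices marked *)
(* [false] have been deleted has a perfect matching, which is then unique.    *)
Fixpoint pairable (s : seq bool) : bool :=
  match s with
  | [::] => true
  | false :: s' => pairable s'
  | true :: true :: s' => pairable s'
  | true :: _ => false
  end.

(** The pattern u0 <= d0 < u1 <= d1 < ... < ur. Weak and strict inequalities alternate because [u]
    stands for the position 2u on a path and [d] for 2d + 1. *)
Fixpoint interlace (us ds : seq nat) : bool :=
  match us, ds with
  | [:: _], [::] => true
  | u :: us', d :: ds' =>
    [&& u <= d, (if us' is u' :: _ then d < u' else false) & interlace us' ds']
  | _, _ => false
  end.

(* What [interlace] leaves to be checked after the head of [us]: now [ds] must *)
(* be the next to move.                                                       *)
Let interlace' (ds us : seq nat) : bool :=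
  match ds, us with
  | [::], [::] => true
  | d :: ds', u :: _ => (d < u) && interlace us ds'
  | _, _ => false
  end.

Variables U D : pred nat.

Definition present (i : nat) := if odd i then ~~ D i./2 else ~~ U i./2.

Let us x n := [seq i <- iota x n | U i].
Let ds x n := [seq i <- iota x n | D i].

Let head_geq (p : pred nat) x n y s :
  [seq i <- iota x n | p i] = y :: s -> x <= y.
Proof.
move=> e; have : y \in [seq i <- iota x n | p i] by rewrite e mem_head.
by rewrite mem_filter mem_iota => /and3P[].
Qed.

Let usS x n : us x n.+1 = if U x then x :: us x.+1 n else us x.+1 n.
Proof. by []. Qed.

Let dsS x n : ds x n.+1 = if D x then x :: ds x.+1 n else ds x.+1 n.
Proof. by []. Qed.

Let presentU x : present x.*2 = ~~ U x.
Proof. by rewrite /present odd_double doubleK. Qed.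

Let presentD x : present x.*2.+1 = ~~ D x.
Proof. by rewrite /present /= odd_double uphalf_double. Qed.

(** The induction runs along the path, so it needs a statement for each parity of the starting
    vertex. *)
Let pairable_interlace2 n : forall x,
  pairable [seq present i | i <- iota x.*2 n.*2.+1] = interlace (us x n.+1) (ds x n)
  /\ pairable [seq present i | i <- iota x.*2.+1 n.*2] = interlace' (ds x n) (us x.+1 n).
Proof.
elim: n => [|n IH] x; first by rewrite /= presentU /us /ds /=; case: (U x).
have [IH1 IH2] := IH x.+1.
have c2 : pairable [seq present i | i <- iota x.*2.+1 n.+1.*2] =
          interlace' (ds x n.+1) (us x.+1 n.+1).
  have -> : iota x.*2.+1 n.+1.*2 = x.*2.+1 :: iota x.+1.*2 n.*2.+1 by [].
  rewrite map_cons presentD dsS; have [Dx|nDx] := boolP (D x).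
    rewrite [LHS]IH1; case e: (us x.+1 n.+1) => [|u r] //.
    by rewrite [RHS]/= (head_geq e).
  have -> : iota x.+1.*2 n.*2.+1 = x.+1.*2 :: iota x.+1.*2.+1 n.*2 by [].
  rewrite map_cons presentU usS.
  have [Ux|nUx] := boolP (U x.+1); last exact: IH2.
  rewrite /=; case e: (ds _ _) => [|d r] //=.
  by rewrite ltnNge (head_geq e).
split=> //.
have -> : iota x.*2 n.+1.*2.+1 = x.*2 :: iota x.*2.+1 n.+1.*2 by [].
rewrite map_cons presentU usS; have [Ux|nUx] := boolP (U x).
  rewrite [LHS]c2; case e: (ds _ _) => [|d r] /=; last rewrite (head_geq e) /=;
  by case: (us _ _).
have -> : iota x.*2.+1 n.+1.*2 = x.*2.+1 :: iota x.+1.*2 n.*2.+1 by [].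
rewrite map_cons presentD dsS; have [Dx|nDx] := boolP (D x); last exact: IH1.
by case e: (us _ _) => [|u [|v r]] //=; rewrite leqNgt (head_geq e).
Qed.

(** A perfect matching exists iff the deleted vertices leave segments of even length. On a path of
    odd length starting at 0, this says that the deleted positions alternate in parity and that the
    first and the last are even. *)
Lemma pairable_interlace n :
  pairable [seq present i | i <- iota 0 n.*2.+1] =
  interlace [seq i <- iota 0 n.+1 | U i] [seq i <- iota 0 n | D i].
Proof. by have [] := pairable_interlace2 n 0. Qed.

End Interlacing.

(** * Perfect matchings of a graph as exact covers by edges *)

Section Graph.

Variables (T : finType) (adj : rel T).
Hypothesis adj_irr : irreflexive adj.
Hypothesis adj_sym : symmetric adj.

Definition edge (L : {set T}) := [exists t, exists u, adj t u && (L == [set t; u])].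

Lemma edgeP L : reflect (exists t u, adj t u /\ L = [set t; u]) (edge L).
Proof.
apply: (iffP existsP) => [[t /existsP[u /andP[tu /eqP->]]]|[t [u [tu ->]]]].
  by exists t, u.
by exists t; apply/existsP; exists u; rewrite tu eqxx.
Qed.

Lemma covers_isolated (R : {set T}) t : t \in R ->
  (forall u, u \in R -> ~~ adj t u) -> #|covers edge R| = 0.
Proof.
move=> tR iso; apply/eqP; rewrite cards_eq0; apply/eqP/setP=> M; rewrite [RHS]in_set0.
apply/negP=> /coversP[pM eM].
have : t \in cover M by rewrite (cover_partition pM).
case/bigcupP => L LM; have sL := partitionS pM LM.
have /edgeP[a [b [ab eL]]] := eM L LM.
have aR : a \in R by apply: (subsetP sL); rewrite eL !inE eqxx.
have bR : b \in R by apply: (subsetP sL); rewrite eL !inE eqxx orbT.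
rewrite eL !inE => /orP[]/eqP e; move: ab; rewrite -e; last rewrite adj_sym.
  exact/negP/iso.
exact/negP/iso.
Qed.

(** The edge at a leaf is forced. This is the cut of [R] into [[set t]] and the rest, with that edge
    as the only cut tile; not using it would leave [t] isolated. *)
Lemma covers_leaf (R : {set T}) t u : t \in R -> u \in R -> adj t u ->
  (forall v, v \in R -> adj t v -> v = u) ->
  #|covers edge R| = #|covers edge (R :\ t :\ u)|.
Proof.
move=> tR uR tu uniq_u.
have neq : u != t by apply: contraTneq tu => ->; rewrite adj_irr.
have nut : (t == u) = false by rewrite eq_sym (negPf neq).
have {1}-> : R = [set t] :|: (R :\ t) by rewrite setD1K.
set X : {set {set T}} := [set [set t; u]].
have dis : [disjoint [set t] & R :\ t] by rewrite disjoints1 !inE eqxx.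
have tX : trivIset X by rewrite trivIset1.
have sX : {in X, forall L, [/\ edge L, L \subset [set t] :|: (R :\ t),
  ~~ (L \subset [set t]) & ~~ (L \subset R :\ t)]}.
  move=> L; rewrite inE => /eqP->; split.
  - by apply/edgeP; exists t, u.
  - by rewrite setD1K // subUset !sub1set tR.
  - by rewrite subUset !sub1set !inE (negPf neq) andbF.
  - by rewrite subUset !sub1set !inE eqxx.
have nX L : edge L -> L \subset [set t] :|: (R :\ t) ->
    [|| L \subset [set t], L \subset R :\ t | L \in X].
  case/edgeP=> a [b [ab ->]]; rewrite setD1K // !subUset !sub1set !inE.
  move=> /andP[aR bR]; rewrite aR bR !andbT.
  have [ea|_] := eqVneq a t.
    have eb : b = u by apply: uniq_u => //; rewrite -ea.
    by rewrite ea eb eqxx !orbT.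
  have [eb|_] := eqVneq b t; last by rewrite orbT.
  have ea : a = u by apply: uniq_u => //; rewrite -eb adj_sym.
  by rewrite ea eb setUC eqxx !orbT.
rewrite (card_covers_sum dis tX sX nX).
rewrite (bigD1 X) ?powersetE //= big1 ?addn0.
  rewrite /cover big_set1.
  have -> : [set t] :\: [set t; u] = set0.
    by apply/eqP; rewrite setD_eq0 sub1set !inE eqxx.
  rewrite covers0 mul1n; congr #|pred_of_set (covers _ _)|.
  by apply/setP=> x; rewrite !inE negb_or; case: eqP; case: eqP.
move=> C /andP[]; rewrite powersetE subset1 => /orP[/eqP->|/eqP-> _]; first by rewrite eqxx.
rewrite /cover big_set0 setD0 (@covers_isolated [set t] t) ?mul0n ?inE //.
by move=> v; rewrite inE => /eqP->; rewrite adj_irr.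
Qed.

(** An induced path; only later vertices are inspected, since [adj] is symmetric. *)
Fixpoint chain (l : seq T) : bool :=
  if l is v :: l' then
    [&& v \notin l', all (fun w => adj v w == (ohead l' == Some w)) l' & chain l']
  else true.

(** The first remaining vertex of the path is a leaf or is isolated, so every choice is forced and
    there is at most one cover. *)
Lemma covers_chain (l : seq T) (p : pred T) : chain l ->
  #|covers edge [set x in l | p x]| = pairable (map p l).
Proof.
have [n le_ln] := ubnP (size l); elim: n l le_ln => // n IH [|v l] /= le_ln.
  by move=> _; rewrite (_ : [set x in [::] | p x] = set0) ?covers0 //; apply/setP=> x; rewrite !inE.
case/and3P=> vl /allP av cl.
have drop_absent w (s : seq T) : p w = false ->
   [set x in w :: s | p x] = [set x in s | p x].
  move=> pw; apply/setP=> x; rewrite !inE.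
  by case: eqP => // ->; rewrite pw !andbF.
have [pv|npv] := boolP (p v); last first.
  rewrite drop_absent ?(negPf npv) //; exact: IH.
case: l vl av cl le_ln => [|w l] /= vl av cl le_ln.
  rewrite (@covers_isolated _ v) ?inE ?eqxx // => u.
  by rewrite !inE => /andP[/eqP-> _]; rewrite adj_irr.
have [nwl aw cl'] := and3P cl.
have vu u : u \in w :: l -> adj v u = (w == u).
  by move=> /av/eqP->.
have [pw|npw] := boolP (p w); last first.
  rewrite (@covers_isolated _ v) ?inE ?eqxx // => u.
  rewrite !inE => /andP[/orP[/eqP->|h] pu]; first by rewrite adj_irr.
  rewrite vu ?inE //; apply: contraNneq npw => ->; exact: pu.
rewrite -(IH l) //; last exact: ltnW.
have vS : v \in [set x in v :: w :: l | p x] by rewrite !inE eqxx.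
have wS : w \in [set x in v :: w :: l | p x] by rewrite !inE eqxx orbT.
rewrite (covers_leaf vS wS).
- congr #|pred_of_set (covers _ _)|; apply/setP=> x; rewrite !inE.
move: vl; rewrite inE negb_or => /andP[nvw nvl].
have [->|nxw] := eqVneq x w; first by rewrite (negPf nwl).
by have [->|nxv] := eqVneq x v; first by rewrite (negPf nvl).
- by rewrite vu ?eqxx // mem_head.
- move=> u; rewrite inE => /andP[]; rewrite in_cons => /orP[/eqP->|h _].
    by rewrite adj_irr.
  by rewrite vu // => /eqP.
Qed.

Lemma covers_imset (f : T -> T) (R : {set T}) : involutive f ->
  {mono f : t u / adj t u} -> #|covers edge (f @: R)| = #|covers edge R|.
Proof.
move=> fK fadj; have finj := inv_inj fK.
pose F (M : {set {set T}}) := [set f @: (L : {set T}) | L in M].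
have imK : involutive (fun L : {set T} => f @: L).
  by move=> L; rewrite -imset_comp (eq_imset _ fK) imset_id.
have FK : involutive F.
  by move=> M; rewrite /F -imset_comp (eq_imset _ imK) imset_id.
have edgef L : edge L -> edge (f @: L).
  case/edgeP=> t [u [tu ->]]; apply/edgeP; exists (f t), (f u).
  by rewrite fadj imsetU !imset_set1.
have FS S M : M \in covers edge S -> F M \in covers edge (f @: S).
  case/coversP=> pM eM; apply/coversP; split.
    by rewrite imset_partition //; apply: in2W.
  by move=> _ /imsetP[L LM ->]; apply/edgef/eM.
rewrite -(card_imset (mem (covers edge R)) (inv_inj FK)).
congr #|pred_of_set _|; apply/setP=> M; apply/idP/imsetP => [MR|[M' MR ->]].
  by exists (F M); rewrite ?FK // -[R]imK FS.
exact: FS.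
Qed.

End Graph.

(** * Strips of the triangular lattice *)

Section Lattice.

Variables w h : nat.

(** The three neighbors of the up triangle at (x, y) are the down triangles at (x, y), (x-1, y) and
    (x, y-1). *)
Definition up_adjacent (x y x' y' : nat) : bool :=
  [|| (x' == x) && (y' == y), (x == x'.+1) && (y' == y)
    | (x' == x) && (y == y'.+1)].

Lemma adjacentE (t u : tri w h) : adjacent t u =
  let: (x, y, b) := t in let: (x', y', b') := u in
  (b != b') && (if b then up_adjacent x y x' y' else up_adjacent x' y' x y).
Proof.
case: t u => [[x y] b] [[x' y'] b'].
rewrite /adjacent /shared_vertices /up_adjacent size_filter.
have excl (i j : nat) : [&& ~~ ((i == j) && (i.+1 == j)),
    ~~ ((i == j) && (i == j.+1)) & ~~ ((i.+1 == j) && (i == j.+1))] by lia.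
have := excl x x'; have := excl y y'.
by case: b b' => [] []; rewrite /= !inE -!pair_eqE /pair_eq /= ?eqSS
  ?[_ == x :> nat]eq_sym ?[_ == y :> nat]eq_sym ?[_ == x.+1 :> nat]eq_sym
  ?[_ == y.+1 :> nat]eq_sym;
  case: (nat_of_ord x == x'); case: (x.+1 == x'); case: (nat_of_ord x == x'.+1);
  case: (nat_of_ord y == y'); case: (y.+1 == y'); case: (nat_of_ord y == y'.+1).
Qed.

Lemma adjacent_irr : irreflexive (@adjacent w h).
Proof. by move=> [[x y] b]; rewrite adjacentE eqxx. Qed.

Lemma adjacent_sym : symmetric (@adjacent w h).
Proof. by move=> [[x y] b] [[x' y'] b']; rewrite !adjacentE; case: b b' => [] []. Qed.

(* The triangles of strip k lie between the lines x + y = k and x + y = k + 1. *)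
Definition strip (t : tri w h) : nat := t.1.1 + t.1.2 + ~~ t.2.

End Lattice.

Section Square.

Variable N : nat.
Implicit Types (x : 'I_N) (S : {set 'I_N}) (t : tri N N).

(* The two halves of the lozenge [crossing k x] lie in the strips k and k + 1. *)
(* The subtraction in [codiag] is only meaningful for x <= k < N.             *)
Definition codiag (k : nat) x : 'I_N := insubd x (k - x).
Definition up k x : tri N N := (x, codiag k x, true).
Definition down k x : tri N N := (x, codiag k x, false).
Definition crossing k x : {set tri N N} := [set up k x; down k x].
Definition below (k : nat) : {set 'I_N} := [set x : 'I_N | x <= k].

Lemma codiagE k x : k < N -> codiag k x = k - x :> nat.
Proof. by move=> kN; rewrite val_insubd (leq_ltn_trans (leq_subr _ _) kN). Qed.

Lemma up_inj k : injective (up k).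
Proof. by move=> x x' [->]. Qed.

Lemma down_inj k : injective (down k).
Proof. by move=> x x' [->]. Qed.

Lemma strip_up k x : k < N -> x <= k -> strip (up k x) = k.
Proof. by move=> kN xk; rewrite /strip /= codiagE //; lia. Qed.

Lemma strip_down k x : k < N -> x <= k -> strip (down k x) = k.+1.
Proof. by move=> kN xk; rewrite /strip /= codiagE //; lia. Qed.

Lemma adjacent_up_down k x : k < N -> x <= k -> adjacent (up k x) (down k x).
Proof. by move=> kN xk; rewrite adjacentE /= /up_adjacent !eqxx. Qed.

Lemma mem_crossing k x t : t \in crossing k x -> t.1.1 = x.
Proof. by rewrite !inE => /orP[] /eqP->. Qed.

Lemma crossing_inj k : injective (crossing k).
Proof.
move=> x x' e; have : up k x \in crossing k x' by rewrite -e !inE eqxx.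
by move/mem_crossing.
Qed.

(** Of the three kinds of lozenges, only the one made of the two halves of the same unit rhombus
    meets two strips. *)
Lemma adjacent_strip k t u : adjacent t u -> k < N ->
  strip t <= k -> k < strip u ->
  exists2 x : 'I_N, x <= k & t = up k x /\ u = down k x.
Proof.
move: t u => [[x y] b] [[x' y'] b']; rewrite adjacentE /strip /up_adjacent.
case: b; case: b' => //= h kN hk1 hk2; last by lia.
have [ex ey] : x' = x :> nat /\ y' = y :> nat by move: h; lia.
have xk : x <= k by lia.
exists x => //; rewrite /up /down.
have ey' : y = codiag k x by apply: val_inj; rewrite /= codiagE //; lia.
by split; congr (_, _, _) => //; [apply: val_inj|rewrite -ey'; apply: val_inj].
Qed.

Section CutStrip.

Variables (k : nat) (A B : {set tri N N}).
Hypothesis kN : k < N.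
Hypothesis leA : {in A, forall t, strip t <= k}.
Hypothesis gtB : {in B, forall t, k < strip t}.
Hypothesis upA : {in below k, forall x, up k x \in A}.
Hypothesis downB : {in below k, forall x, down k x \in B}.

(** The crossing lozenges are disjoint and are coded by their abscissas [D]. Each leaves a dent on
    either side of the cut: an up triangle of [A] and a down triangle of [B]. *)
Lemma card_covers_strip (Z : pred {set {set tri N N}}) :
  #|[set M in covers (@lozenge N N) (A :|: B) | Z (M :&: crossing k @: below k)]| =
  \sum_(D in powerset (below k) | Z (crossing k @: D))
     #|covers (@lozenge N N) (A :\: up k @: D)|
       * #|covers (@lozenge N N) (B :\: down k @: D)|.
Proof.
rewrite card_covers_cut; first last.
- move=> L /(@edgeP _ (@adjacent N N))[t [u [tu ->]]].
  rewrite !subUset !sub1set !inE.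
  have sideA v : v \in A :|: B -> strip v <= k -> v \in A.
    by rewrite inE => /orP[//|/gtB]; rewrite ltnNge => /negPf->.
  have sideB v : v \in A :|: B -> k < strip v -> v \in B.
    by rewrite inE => /orP[/leA|//]; rewrite leqNgt => /negPf->.
  rewrite -!in_setU => /andP[/[dup] /sideA At /sideB Bt /[dup] /sideA Au /sideB Bu].
  case: (leqP (strip t) k) At Bt => [ht /(_ isT) tA _|ht _ /(_ isT) tB];
  case: (leqP (strip u) k) Au Bu => [hu /(_ isT) uA _|hu _ /(_ isT) uB].
  + by rewrite tA uA.
  + have [x xk [-> ->]] := adjacent_strip tu kN ht hu.
    by apply/or3P/Or33/(imset_f (crossing k)); rewrite inE.
  + rewrite adjacent_sym in tu; have [x xk [-> ->]] := adjacent_strip tu kN hu ht.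
    by apply/or3P/Or33; rewrite setUC; apply/(imset_f (crossing k)); rewrite inE.
  + by rewrite tB uB orbT.
- move=> L /imsetP[x xk ->]; have := xk; rewrite inE => xk'; split.
  + by apply/(@edgeP _ (@adjacent N N)); exists (up k x), (down k x); rewrite adjacent_up_down.
  + by rewrite subUset !sub1set !inE upA ?downB ?orbT.
  + rewrite subUset !sub1set negb_and orbC; apply/orP; left; apply/negP => /leA.
    by rewrite strip_down // ltnn.
  + rewrite subUset !sub1set negb_and; apply/orP; left; apply/negP => /gtB.
    by rewrite strip_up // ltnn.
- apply/trivIsetP => _ _ /imsetP[x _ ->] /imsetP[x' _ ->] ne.
  rewrite -setI_eq0; apply/eqP/setP=> t; rewrite in_setI in_set0.
  apply/negP=> /andP[/mem_crossing e1 /mem_crossing e2].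
  by move: ne; rewrite -e1 -e2 eqxx.
- rewrite -setI_eq0; apply/eqP/setP=> t; rewrite in_setI in_set0.
  by apply/negP=> /andP[/leA h1 /gtB]; rewrite ltnNge h1.
have -> : powerset (crossing k @: below k) =
          [set crossing k @: (D : {set 'I_N}) | D in powerset (below k)].
  apply/setP=> C; rewrite powersetE; apply/idP/imsetP => [/subsetP sC|[D]].
    exists [set x in below k | crossing k x \in C].
      by rewrite powersetE; apply/subsetP=> x; rewrite inE => /andP[].
    apply/setP=> L; apply/idP/imsetP => [LC|[x]]; last first.
      by rewrite inE => /andP[_ xC ->].
    by have /imsetP[x xk eL] := sC L LC; exists x; rewrite // inE xk -eL.
  by rewrite powersetE => sD ->; apply: imsetS.
rewrite big_mkcondr big_imset /=; last by apply: in2W; apply/imset_inj/crossing_inj.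
rewrite -big_mkcondr; apply: eq_bigr => D /andP[sD _].
have -> : cover (crossing k @: D) = up k @: D :|: down k @: D.
  rewrite cover_imset; apply/setP=> t; apply/bigcupP/idP => [[x xD]|].
    by rewrite !inE => /orP[]/eqP->; rewrite imset_f ?orbT.
  by rewrite inE => /orP[]/imsetP[x xD ->]; exists x; rewrite // !inE eqxx ?orbT.
have notB x : x \in below k -> up k x \notin B.
  by rewrite inE => xk; apply/negP=> /gtB; rewrite strip_up // ltnn.
have notA x : x \in below k -> down k x \notin A.
  by rewrite inE => xk; apply/negP=> /leA; rewrite strip_down // ltnn.
have DB x : x \in D -> x \in below k by apply/subsetP; rewrite -powersetE.
have -> : A :\: (up k @: D :|: down k @: D) = A :\: up k @: D.
  apply/setP=> t; rewrite !in_setD in_setU negb_or; case: (boolP (t \in A)) => tA.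
    have -> // : t \notin down k @: D; last by rewrite andbT.
    by apply/negP=> /imsetP[x /DB/notA xA et]; rewrite -et tA in xA.
  by rewrite !andbF.
have -> // : B :\: (up k @: D :|: down k @: D) = B :\: down k @: D.
apply/setP=> t; rewrite !in_setD in_setU negb_or; case: (boolP (t \in B)) => tA.
  have -> // : t \notin up k @: D.
  by apply/negP=> /imsetP[x /DB/notB xB et]; rewrite -et tA in xB.
by rewrite !andbF.
Qed.

End CutStrip.

Definition values S : seq nat := [seq val x | x <- enum S].

Lemma values_sorted S : sorted ltn (values S).
Proof.
apply: (subseq_sorted ltn_trans (map_subseq val (filter_subseq _ _))).
by rewrite -enumT val_enum_ord iota_ltn_sorted.
Qed.

Lemma mem_values S (x : 'I_N) : (val x \in values S) = (x \in S).
Proof. by rewrite mem_map ?mem_enum //; apply: val_inj. Qed.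

Lemma values_filter S n : (forall x, x \in S -> x < n) ->
  values S = [seq i <- iota 0 n | i \in values S].
Proof.
move=> lt_n; apply: (irr_sorted_eq ltn_trans ltnn) => [||i].
- exact: values_sorted.
- by apply: sorted_filter (iota_ltn_sorted _ _); apply: ltn_trans.
rewrite mem_filter mem_iota /= add0n; case: (boolP (i \in values S)) => //= /mapP[x].
by rewrite mem_enum => /lt_n xn ->; rewrite xn.
Qed.

Definition slab (lo hi : nat) : {set tri N N} := [set t | lo <= strip t <= hi].

End Square.

Lemma chain_map (T : finType) (adj : rel T) (v : nat -> T) m n :
  (forall i j, i < m + n -> j < m + n -> v i = v j -> i = j) ->
  (forall i j, i < m + n -> j < m + n -> adj (v i) (v j) = (j == i.+1) || (i == j.+1)) ->
  chain adj (map v (iota m n)).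
Proof.
elim: n m => //= n IH m vinj vadj; apply/and3P; split.
- apply/mapP=> -[j]; rewrite mem_iota => hj /vinj e.
  by have := e _ _; lia.
- apply/allP=> _ /mapP[j hj ->]; move: hj; rewrite mem_iota => hj.
  rewrite vadj; try lia; case: n IH vinj vadj hj => [|n] IH vinj vadj hj; first by lia.
  rewrite /= (inj_eq (@Some_inj _)); apply/eqP.
  have [->|ne] := eqVneq j m.+1; first by rewrite eqxx.
  rewrite orFb; have -> : (m == j.+1) = false by lia.
  by apply/esym/eqP => /vinj e; have := e _ _; lia.
- by apply: IH => i j hi hj; [apply: vinj | apply: vadj]; lia.
Qed.

Section StripCount.

Variables (N s : nat).
Hypothesis sN : s < N.
Variables U D : {set 'I_N}.
Hypothesis ltU : forall x, x \in U -> x <= s.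
Hypothesis ltD : forall x, x \in D -> x < s.

Let x0 : 'I_N := Ordinal (leq_ltn_trans (leq0n s) sN).
Let ins i : 'I_N := insubd x0 i.
Let insE i : i < N -> ins i = i :> nat.
Proof. by move=> iN; rewrite val_insubd iN. Qed.

(* The triangles of strip s, along which adjacency is that of a path.         *)
Let v i := if odd i then down s.-1 (ins i./2) else up s (ins i./2).

Let vE i : i < s.*2.+1 ->
  v i = (ins i./2, ins (s - uphalf i), ~~ odd i).
Proof.
move=> hi; rewrite /v /up /down.
have h1 : ins i./2 = i./2 :> nat by apply: insE; lia.
have h2 : ins (s - uphalf i) = s - uphalf i :> nat by apply: insE; lia.
case: ifP => oi; congr (_, _, _); apply: ord_inj; rewrite codiagE ?h1 ?h2; lia.
Qed.

(** A single strip is a path of alternately up and down triangles that begins and ends with an up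
    one, so it has at most one tiling, and [pairable_interlace] decides when. *)
Lemma card_covers_slab :
  #|covers (@lozenge N N) (slab N s s :\: up s @: U :\: down s.-1 @: D)| =
  interlace (values U) (values D).
Proof.
pose p (t : tri N N) := (t \notin up s @: U) && (t \notin down s.-1 @: D).
have -> : slab N s s :\: up s @: U :\: down s.-1 @: D =
    [set t in map v (iota 0 s.*2.+1) | p t].
  apply/setP=> t; rewrite !in_setD [RHS]inE /p andbA [RHS]andbC.
  congr (_ && _); first by rewrite andbC.
  rewrite inE.
  apply/idP/mapP => [|[i]].
    (* Along the strip, the up triangle of abscissa [x] is at position 2x and the down one at 2x +
       1. *)
    case: t => [[x y] b] ht; exists ((x : nat).*2 + ~~ b).
      by move: ht; rewrite mem_iota /strip /=; case: b => /=; lia.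
    rewrite vE; last by move: ht; rewrite /strip /=; case: b => /=; lia.
    congr (_, _, _); try apply: ord_inj; rewrite ?insE;
      move: ht; rewrite /strip /=; case: b => /=; lia.
  rewrite mem_iota /= add0n => hi ->; rewrite vE // /strip /= !insE; lia.
rewrite (@covers_chain _ _ (@adjacent_irr N N) (@adjacent_sym N N)); last first.
  apply: chain_map => i j; rewrite add0n => hi hj; rewrite !vE //.
    case=> /(congr1 val) /=; rewrite !insE; try lia.
  rewrite adjacentE /up_adjacent !insE; try lia.
  by case oi: (odd i); case oj: (odd j) => /=; lia.
rewrite (values_filter (n := s.+1) ltU) (values_filter ltD) -pairable_interlace.
congr (nat_of_bool (pairable _)); rewrite -map_comp; apply/eq_in_map => i.
rewrite mem_iota /= add0n => hi.
have inv S : (i./2 \in values S) = (ins i./2 \in S).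
  by rewrite -mem_values /= insE //; lia.
rewrite /= /p /v /present; case: ifP => oi.
  rewrite (mem_imset _ _ (@down_inj N s.-1)) inv.
  have -> // : down s.-1 (ins i./2) \notin up s @: U.
  by apply/imsetP=> -[].
rewrite (mem_imset _ _ (@up_inj N s)) inv.
have -> : up s (ins i./2) \notin down s.-1 @: D; last by rewrite andbT.
by apply/imsetP=> -[].
Qed.

End StripCount.

(** * The halves of the hexagon as dented trapezoids *)

Section LeftHalf.

Variables (N c : nat).

(* The left half of the hexagon up to strip k, with dents U on its long side. *)
Definition dented k (U : {set 'I_N}) : nat :=
  #|covers (@lozenge N N) (slab N c k :\: up k @: U)|.

(** The first strip has one more up triangle than down triangles, and any single dent makes it
    tileable. *)
Lemma dented_base (cN : c < N) (U : {set 'I_N}) : U \subset below N c ->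
  dented c U = (#|U| == 1).
Proof.
move=> sU; have := @card_covers_slab N c cN U set0.
rewrite imset0 setD0 /dented => ->.
- have -> : values (set0 : {set 'I_N}) = [::] by rewrite /values enum_set0.
  have <- : size (values U) = #|U| by rewrite size_map -cardE.
  by case: (values U) => [|u [|u' r]].
- by move=> x /(subsetP sU); rewrite inE.
- by move=> x; rewrite inE.
Qed.

(** Cut off the last strip: the lozenges that enter it, at [D], dent what is left, and the strip
    itself contributes 1 or 0. *)
Lemma dented_step k (U : {set 'I_N}) : c <= k -> k.+1 < N ->
  U \subset below N k.+1 ->
  dented k.+1 U = \sum_(D in powerset (below N k) | interlace (values U) (values D))
    dented k D.
Proof.
move=> ck kN sU; have sB x : x \in U -> x <= k.+1 by move/(subsetP sU); rewrite inE.
have -> : dented k.+1 U = #|[set M in covers (@lozenge N N)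
    (slab N c k :|: (slab N k.+1 k.+1 :\: up k.+1 @: U)) | predT
    (M :&: [set crossing k x | x in below N k])]|.
  apply: eq_card => M; rewrite [RHS]inE andbT; congr (M \in covers _ _).
  apply/setP=> t; rewrite !(in_setD, in_setU, inE).
  case: (leqP (strip t) k) => tk.
    have -> : t \notin up k.+1 @: U.
      by apply/imsetP=> -[x /sB xk et]; move: tk; rewrite et strip_up // ltnn.
    by rewrite /=; lia.
  by case: (t \notin _) => /=; lia.
rewrite card_covers_strip; first 1 last.
- exact: ltnW.
- by move=> t; rewrite inE => /andP[].
- by move=> t; rewrite !inE => /and3P[].
- by move=> x; rewrite !inE => xk; rewrite strip_up ?leqnn ?andbT // ltnW.
- move=> x; rewrite !inE => xk; rewrite strip_down ?leqnn ?andbT //; last exact: ltnW.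
  by apply/imsetP=> -[].
rewrite [RHS]big_mkcondr; apply: eq_big => [D|D /andP[]]; first by rewrite andbT.
rewrite powersetE => /subsetP sD _; rewrite (@card_covers_slab N k.+1 kN U D sB).
  by case: interlace; rewrite ?muln1 ?muln0.
by move=> x /sD; rewrite inE.
Qed.

End LeftHalf.

Section Reflection.

Variable N : nat.

(** The half-turn about the center of the rhombus; it exchanges up and down triangles. *)
Definition reflect_tri (t : tri N N) : tri N N :=
  (rev_ord t.1.1, rev_ord t.1.2, ~~ t.2).

Lemma reflect_triK : involutive reflect_tri.
Proof. by case=> [[x y] b]; rewrite /reflect_tri /= !rev_ordK negbK. Qed.

Lemma adjacent_reflect : {mono reflect_tri : t u / adjacent t u}.
Proof.
move=> [[x y] b] [[x' y'] b']; rewrite !adjacentE /up_adjacent /=.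
case: x y x' y' => [x hx] [y hy] [x' hx'] [y' hy'] /=.
by case: b b' => [] [] //=; lia.
Qed.

Lemma strip_reflect t : strip (reflect_tri t) = N.*2.-1 - strip t.
Proof.
case: t => [[x y] b]; rewrite /strip /=.
case: x y => [x hx] [y hy] /=; case: b => /=; lia.
Qed.

End Reflection.

Lemma sum_shared_vertices w h (t u : tri w h) : adjacent t u ->
  \sum_(p <- shared_vertices t u) p.1 = t.1.1 + u.1.1 + 1 /\
  \sum_(p <- shared_vertices t u) p.2 = t.1.2 + u.1.2 + 1.
Proof.
have n1 i : (i == i.+1) = false by lia.
have n2 i : (i.+1 == i) = false by lia.
have n3 i : (i.+2 == i) = false by lia.
have n4 i : (i == i.+2) = false by lia.
have E := (eqSS, n1, n2, n3, n4, eqxx, andbF, andbT, orbF, orbT).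
case: t u => [[x y] b] [[x' y'] b']; rewrite adjacentE /up_adjacent.
rewrite /shared_vertices !big_filter.
by case: b b' => [] [] //= /or3P[] /andP[/eqP e1 /eqP e2]; rewrite !big_cons !big_nil;
  rewrite /= !inE -!pair_eqE /pair_eq /= ?e1 ?e2 !E /=; lia.
Qed.

Lemma reflect_up N (x : 'I_N) : reflect_tri (up N.-1 (rev_ord x)) = down N.-1 x.
Proof.
have xN := ltn_ord x; have N1 : N.-1 < N by lia.
rewrite /reflect_tri /down /= rev_ordK; congr (_, _, _); apply: ord_inj.
by rewrite /= !codiagE //=; lia.
Qed.

Section Center.

Variables (a c : nat) (o : 'I_(a + c)).
Hypothesis oE : o.*2.+1 = a + c.
Hypothesis a_gt0 : 0 < a.

Let N := a + c.
Let N1 : N.-1 < N. Proof. by rewrite /N; lia. Qed.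

(** The abscissas of the two halves differ by at most 1 and add up to the even number [o.*2], so
    both equal [o]; the same holds for the ordinates. *)
Lemma central_lozengeE (L : {set tri N N}) :
  central_lozenge L = (L == crossing N.-1 o).
Proof.
have oN : o <= N.-1 by rewrite /N; lia.
have co : codiag N.-1 o = o by apply: ord_inj; rewrite codiagE // /N; lia.
apply/idP/eqP => [|->].
  case/existsP=> t /existsP[u /and4P[tu /eqP->]].
  have [-> ->] := sum_shared_vertices tu; move=> /eqP ex /eqP ey.
  move: tu ex ey; case: t u => [[x y] b] [[x' y'] b'] /=.
  rewrite adjacentE /up_adjacent => tu ex ey.
  have [e1 [e2 [e3 e4]]] :
      x = o :> nat /\ y = o :> nat /\ x' = o :> nat /\ y' = o :> nat.
    by case: b b' tu => [] [] //=; lia.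
  rewrite /crossing /up /down co (ord_inj e1) (ord_inj e2) (ord_inj e3) (ord_inj e4).
  by case: b b' tu => [] [] //= _; rewrite setUC.
apply/existsP; exists (up N.-1 o); apply/existsP; exists (down N.-1 o).
have ad := adjacent_up_down N1 oN; rewrite ad eqxx /=.
have [-> ->] := sum_shared_vertices ad; rewrite /= co -/N.
by apply/andP; split; rewrite /N; lia.
Qed.

Lemma hexagonE : hexagon a a c = slab N c (a + N).-1.
Proof.
apply/setP=> -[[x y] b]; rewrite !inE /vertices /in_hexagon /strip /=.
have := ltn_ord x; have := ltn_ord y; case: b => /=; rewrite /N; lia.
Qed.

(** The cut is the line x + y = [N]. The half-turn maps the upper half, dented at [S], to the lower
    half, dented at the mirror image of [S]. *)
Lemma card_centered_tilings :
  #|centered_tilings a a c| =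
  \sum_(S : {set 'I_N} | o \in S)
    dented c N.-1 S * dented c N.-1 (@rev_ord N @: S).
Proof.
pose X := [set crossing N.-1 x | x in below N N.-1].
pose B := slab N N (a + N).-1.
have oX : crossing N.-1 o \in X by apply: imset_f; rewrite inE /N; lia.
have -> : #|centered_tilings a a c| = #|[set M in covers (@lozenge N N)
    (slab N c N.-1 :|: B) | crossing N.-1 o \in (M :&: X)]|.
  apply: eq_card => M; rewrite !inE oX andbT.
  have -> : slab N c N.-1 :|: B = hexagon a a c.
    rewrite hexagonE; apply/setP=> t; rewrite !inE /N; lia.
  congr (_ && _); apply/exists_inP/idP => [[L LM]|oM].
    by rewrite central_lozengeE => /eqP<-.
  by exists (crossing N.-1 o); rewrite ?central_lozengeE.
rewrite (@card_covers_strip N N.-1 _ B N1 _ _ _ _ (fun C => crossing N.-1 o \in C)).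
- apply: eq_big => [S|S _].
    rewrite (mem_imset _ _ (@crossing_inj N N.-1)).
    have -> // : S \in powerset (below N N.-1).
    by rewrite powersetE; apply/subsetP=> x _; rewrite inE; have := ltn_ord x; rewrite /N; lia.
  congr (_ * _).
  rewrite -[LHS](covers_imset _ (@reflect_triK N) (@adjacent_reflect N)).
  congr #|pred_of_set (covers _ _)|; apply/setP=> t.
  rewrite -[t](@reflect_triK N) (mem_imset _ _ (inv_inj (@reflect_triK N))).
  rewrite !in_setD; congr (~~ _ && _); last first.
    rewrite !inE strip_reflect; case: t => [[x y] b]; rewrite /strip /=.
    by have := ltn_ord x; have := ltn_ord y; case: b => /=; rewrite /N; lia.
  have -> : [set down N.-1 x | x in S] =
      @reflect_tri N @: (up N.-1 @: (@rev_ord N @: S)).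
    by rewrite -!imset_comp; apply: eq_imset => x; rewrite /= reflect_up.
  by rewrite reflect_triK (mem_imset _ _ (inv_inj (@reflect_triK N))).
- by move=> t; rewrite inE => /andP[].
- by move=> t; rewrite inE /N => /andP[]; lia.
- by move=> x; rewrite !inE => xk; rewrite strip_up // leqnn andbT /N; lia.
- by move=> x; rewrite !inE => xk; rewrite strip_down // /N; lia.
Qed.

End Center.

Import Order.TTheory GRing.Theory Num.Theory.

(** * Interlacing and determinants *)

Lemma interlaceE us ds : interlace us ds = (size us == (size ds).+1) &&
  all (fun i => nth 0 us i <= nth 0 ds i < nth 0 us i.+1) (iota 0 (size ds)).
Proof.
elim: us ds => [|u us IH] [|d ds] //=; first by case: us {IH}.
rewrite IH eqSS (iotaDl 1 0) all_map; case: us {IH} => [|u' us] //=.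
  by rewrite andbF.
by case: (u <= d); case: (d < u'); rewrite /= ?andbF.
Qed.

Section Points.

Variables (N : nat) (o : 'I_N).

Definition pt (S : {set 'I_N}) (i : nat) : 'I_N := nth o (enum S) i.

Lemma nth_values (S : {set 'I_N}) i : i < #|S| -> nth 0 (values S) i = pt S i.
Proof. by move=> iS; rewrite (nth_map o) -?cardE. Qed.

Lemma pt_mem (S : {set 'I_N}) i : i < #|S| -> pt S i \in S.
Proof. by move=> iS; rewrite -mem_enum mem_nth -?cardE. Qed.

Lemma pt_inj (S : {set 'I_N}) i j : i < #|S| -> j < #|S| -> pt S i = pt S j -> i = j.
Proof.
by move=> iS jS /eqP; rewrite nth_uniq ?enum_uniq -?cardE // => /eqP.
Qed.

Lemma pt_onto (S : {set 'I_N}) x : x \in S -> exists2 i, i < #|S| & pt S i = x.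
Proof.
move=> xS; exists (index x (enum S)); first by rewrite cardE index_mem mem_enum.
by rewrite /pt nth_index // mem_enum.
Qed.

Lemma pt_image r (S : {set 'I_N}) : #|S| = r -> S = [set pt S (i : 'I_r) | i : 'I_r].
Proof.
move=> Sr; apply/setP=> x; apply/idP/imsetP => [/pt_onto[i]|[i _ ->]].
  by rewrite Sr => ir <-; exists (Ordinal ir).
by rewrite pt_mem // Sr.
Qed.

Lemma pt_lt (S : {set 'I_N}) i j : i < j -> j < #|S| -> pt S i < pt S j.
Proof.
move=> ij jS; rewrite -!nth_values //; last exact: ltn_trans jS.
have := sorted_ltn_nth ltn_trans 0 (values_sorted S).
by apply; rewrite ?inE ?size_map -?cardE //; exact: ltn_trans jS.
Qed.

Lemma pt_incr r (f : 'I_r -> 'I_N) : {homo f : i j / i < j} ->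
  let S := [set f i | i : 'I_r] in #|S| = r /\ forall i : 'I_r, pt S i = f i.
Proof.
move=> fincr S.
have finj : injective f.
  move=> i j e; apply: ord_inj; have := @fincr i j; have := @fincr j i.
  by rewrite e ltnn; case: ltngtP => // _ h1 h2; [have := h1 isT | have := h2 isT].
have Sr : #|S| = r by rewrite card_imset // card_ord.
split=> // i; apply: val_inj; rewrite /= -nth_values ?Sr //.
have -> : values S = [seq val (f j) | j <- enum 'I_r].
  apply: (irr_sorted_eq ltn_trans ltnn (values_sorted S)) => [|x].
    apply/(sortedP 0) => k; rewrite size_map size_enum_ord => kr.
    rewrite !(nth_map i) -?enumT ?size_enum_ord ?(ltnW kr) //.
    by apply: fincr; rewrite !nth_enum_ord // (ltnW kr).
  rewrite /values; apply/mapP/mapP => [[y]|[j _ ->]].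
    by rewrite mem_enum => /imsetP[j _ ->] ->; exists j; rewrite ?mem_enum.
  by exists (f j); rewrite // mem_enum imset_f.
by rewrite (nth_map i) ?size_enum_ord // nth_ord_enum.
Qed.

End Points.

Section Dets.
Local Open Scope ring_scope.

(** Multilinearity in the rows. *)
Lemma det_sum_family (R : comRingType) r (T : finType) (F : 'I_r -> pred T)
    (A : T -> 'I_r -> R) :
  \det (\matrix_(i, j) \sum_(x | F i x) A x j) =
  \sum_(f in family F) \det (\matrix_(i, j) A (f i) j).
Proof.
rewrite exchange_big /=; apply: eq_bigr => s _.
rewrite -big_distrr /=; congr (_ * _).
under eq_bigr do rewrite mxE.
by rewrite bigA_distr_big_dep; apply: eq_bigr => f _; apply: eq_bigr => i _; rewrite mxE.
Qed.

(** Subtracting from each row the previous one, which is multiplication by the unitriangular [L],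
    turns the first column of ones into a unit vector; then expand along it. *)
Lemma det_row_differences (R : comRingType) r (a : nat -> nat -> R) :
  (forall i, a i 0%N = 1) ->
  \det (\matrix_(i < r, j < r) (a i.+1 j.+1 - a i j.+1)) =
  \det (\matrix_(i < r.+1, j < r.+1) a i j).
Proof.
move=> a1; pose A : 'M[R]_r.+1 := \matrix_(i, j) a i j.
pose L : 'M[R]_r.+1 := \matrix_(i, j) ((i == j)%:R - (i == j.+1 :> nat)%:R).
have detL : \det L = 1.
  rewrite det_trig; last first.
    apply/is_trig_mxP => i j ij; rewrite mxE.
    have -> : (i == j) = false by apply/negP=> /eqP e; rewrite e ltnn in ij.
    have -> : (i == j.+1 :> nat) = false by rewrite ltn_eqF // ltnS ltnW.
    by rewrite subr0.
  rewrite big1 // => i _; rewrite mxE eqxx.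
  have -> : (i == i.+1 :> nat) = false by rewrite ltn_eqF.
  by rewrite subr0.
have LA i j : (L *m A) i j = a i j - (if i == 0%N :> nat then 0 else a i.-1 j).
  rewrite mxE; under eq_bigr do rewrite !mxE mulrBl.
  rewrite sumrB (bigD1 i) //= eqxx mul1r big1 ?addr0; last first.
    by move=> k ki; rewrite eq_sym (negPf ki) mul0r.
  congr (_ - _); case: eqP => [i0|/eqP i0].
    by rewrite big1 // => k _; rewrite i0 mul0r.
  have ii : (i.-1 < r.+1)%N by have := ltn_ord i; lia.
  rewrite (bigD1 (Ordinal ii)) //= prednK ?lt0n // eqxx mul1r big1 ?addr0 //.
  move=> k ki; have -> : (i == k.+1 :> nat) = false; last by rewrite mul0r.
  by apply/negP=> /eqP e; case/negP: ki; apply/eqP/ord_inj; rewrite /= e.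
have -> : \det (\matrix_(i < r.+1, j < r.+1) a i j) = \det (L *m A).
  by rewrite det_mulmx detL mul1r.
rewrite (expand_det_col _ ord0) big_ord_recl /= big1 ?addr0; last first.
  by move=> i _; rewrite LA /= !a1 subrr mul0r.
rewrite LA /= a1 subr0 mul1r /cofactor expr0 mul1r; congr (\det _).
by apply/matrixP=> i j; rewrite [RHS]mxE [RHS]mxE LA /= /bump /= !mxE.
Qed.

Lemma sum_bin N (u v j : nat) : (u <= v)%N -> (v <= N)%N ->
  \sum_(x : 'I_N | (u <= x < v)%N) 'C(x, j)%:R = 'C(v, j.+1)%:R - 'C(u, j.+1)%:R :> rat.
Proof.
have hockey n : (n <= N)%N ->
    \sum_(x : 'I_N | (x < n)%N) 'C(x, j)%:R = 'C(n, j.+1)%:R :> rat.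
  move=> nN; rewrite -(big_ord_widen _ (fun x => 'C(x, j)%:R)) //.
  elim: n {nN} => [|n IH]; first by rewrite big_ord0 bin0n.
  by rewrite big_ord_recr /= IH -natrD binS.
move=> uv vN; rewrite -(hockey v) // -(hockey u) ?(leq_trans uv) //.
rewrite [in RHS](bigID (fun x : 'I_N => (x < u)%N)) /=.
have -> : \sum_(x : 'I_N | (x < v)%N && (x < u)%N) ('C(x, j)%:R : rat) =
          \sum_(x : 'I_N | (x < u)%N) 'C(x, j)%:R by apply: eq_bigl => x; lia.
by rewrite [RHS]addrC addKr; apply: eq_bigl => x; lia.
Qed.

End Dets.

Section DentedDet.

Variables (N : nat) (o : 'I_N).

Lemma pt_ffun_inj r : {in [set D : {set 'I_N} | #|D| == r] &,
  injective (fun D => [ffun i : 'I_r => pt o D i])}.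
Proof.
move=> D D'; rewrite !inE => /eqP Dr /eqP D'r /ffunP e.
rewrite (pt_image o Dr) (pt_image o D'r); apply: eq_imset => i.
by have := e i; rewrite !ffunE.
Qed.

Lemma interlace_pt r (U D : {set 'I_N}) : #|U| = r.+1 -> #|D| = r ->
  interlace (values U) (values D) = [forall i : 'I_r, pt o U i <= pt o D i < pt o U i.+1].
Proof.
move=> Ur Dr; rewrite interlaceE !size_map -!cardE Ur Dr eqxx /=.
have e (i : 'I_r) : (nth 0 (values U) i <= nth 0 (values D) i < nth 0 (values U) i.+1)
    = (pt o U i <= pt o D i < pt o U i.+1).
  rewrite !(nth_values o) ?Ur ?Dr //; have := ltn_ord i; lia.
apply/allP/forallP => [h i|h i]; first by rewrite -e; apply: h; rewrite mem_iota /=.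
by rewrite mem_iota /= => ir; rewrite (e (Ordinal ir)); apply: h.
Qed.

Lemma interlace_card (U D : {set 'I_N}) : interlace (values U) (values D) -> #|U| = #|D|.+1.
Proof. by rewrite interlaceE !size_map -!cardE => /andP[/eqP]. Qed.

(** Interlacing sets are independent choices of one point in each interval from u_i to u_(i+1),
    right end excluded: these intervals are consecutive, so any such choice is increasing. *)
Lemma sum_interlace (V : nmodType) r (U : {set 'I_N}) (F : (nat -> 'I_N) -> V) :
  #|U| = r.+1 -> (forall s s' : nat -> 'I_N, (forall i : 'I_r, s i = s' i) -> F s = F s') ->
  (\sum_(D : {set 'I_N} | (#|D| == r) && interlace (values U) (values D)) F (pt o D) =
  \sum_(f in family (fun i : 'I_r => [pred x : 'I_N | (pt o U i <= x < pt o U i.+1)%N]))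
    F (fun i => if insub i is Some i' then f i' else o))%R.
Proof.
move=> Ur Fext.
pose h (D : {set 'I_N}) := [ffun i : 'I_r => pt o D i].
pose S := [set D : {set 'I_N} | (#|D| == r) && interlace (values U) (values D)].
rewrite (eq_bigl (mem (h @: S))); last first.
  move=> f; apply/familyP/imsetP => [fU|[D]]; last first.
    rewrite inE => /andP[/eqP Dr]; rewrite (interlace_pt Ur Dr) => /forallP DU -> i.
    by rewrite ffunE; apply: DU.
  have fincr : {homo f : i j / i < j}.
    move=> i j ij; have /andP[_ h1] := fU i; have /andP[h2 _] := fU j.
    apply: leq_trans h2; apply: leq_trans h1 _.
    move: ij; rewrite leq_eqVlt => /orP[/eqP->//|ij].
    by apply/ltnW/pt_lt => //; rewrite Ur; apply: leqW.
  have [Dr Df] := pt_incr o fincr.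
  exists [set f i | i : 'I_r]; last by apply/ffunP=> i; rewrite ffunE Df.
  rewrite inE Dr eqxx (interlace_pt Ur Dr); apply/forallP=> i; rewrite Df; exact: fU.
rewrite big_imset /=; last first.
  by move=> D D'; rewrite !inE => /andP[Dr _] /andP[D'r _]; apply: pt_ffun_inj; rewrite inE.
rewrite (eq_bigl (mem S)) => [|D]; last by rewrite !inE.
by apply: eq_bigr => D _; apply: Fext => i; rewrite valK ffunE.
Qed.

Definition binmx r (s : nat -> 'I_N) : 'M[rat]_r := (\matrix_(i, j) 'C(s i, j)%:R)%R.

(** By multilinearity the sum moves into the rows, where the hockey-stick identity [sum_bin] yields
    differences of consecutive rows of the larger matrix. *)
Lemma det_binmx_step r (U : {set 'I_N}) : #|U| = r.+1 ->
  (\sum_(D : {set 'I_N} | (#|D| == r) && interlace (values U) (values D))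
     \det (binmx r (pt o D)) = \det (binmx r.+1 (pt o U)))%R.
Proof.
move=> Ur; rewrite (sum_interlace (F := fun s => (\det (binmx r s))%R)) //; last first.
  by move=> s s' e; congr (\det _)%R; apply/matrixP=> i j; rewrite !mxE e.
rewrite -(@det_row_differences _ r (fun i j => 'C(pt o U i, j)%:R)%R); last first.
  by move=> i; rewrite bin0.
have := det_sum_family (fun i : 'I_r => [pred x : 'I_N | (pt o U i <= x < pt o U i.+1)%N])
  (fun x (j : 'I_r) => 'C(x, j)%:R : rat)%R.
have -> : (\matrix_(i < r, j < r) ('C(pt o U i.+1, j.+1)%:R - 'C(pt o U i, j.+1)%:R)
   = \matrix_(i < r, j < r) \sum_(x : 'I_N | [pred x : 'I_N | (pt o U i <= x < pt o U i.+1)%N] x)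
       'C(x, j)%:R :> 'M[rat]_r)%R.
  apply/matrixP=> i j; rewrite !mxE sum_bin //; last exact: ltnW.
  by apply/ltnW/pt_lt => //; rewrite Ur ltnS.
move=> ->; apply: eq_bigr => f _; congr (\det _)%R.
by apply/matrixP=> i j; rewrite !mxE valK.
Qed.

Lemma dented_det c k (U : {set 'I_N}) : c <= k -> k < N -> U \subset below N k ->
  ((dented c k U)%:R =
    if #|U| == (k - c).+1 then \det (binmx (k - c).+1 (pt o U)) else 0 :> rat)%R.
Proof.
move=> /subnKC; move: (k - c) => d <-; elim: d U => [|d IH] U.
  rewrite addn0 => cN sU; rewrite dented_base //; case: eqP => // _.
  by rewrite det_mx11 mxE bin0.
rewrite addnS => kN sU; rewrite dented_step ?leq_addr // natr_sum.
transitivity (\sum_(D : {set 'I_N} | interlace (values U) (values D))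
    if #|D| == d.+1 then \det (binmx d.+1 (pt o D)) else 0 : rat)%R.
  rewrite big_mkcondl; apply: eq_bigr => D UD; rewrite powersetE.
  (* Each point of [D] is smaller than some point of [U], so interlacing alone implies the bound on
     [D]. *)
  have sD : D \subset below N (c + d).
    apply/subsetP=> x xD; rewrite inE.
    have eU := interlace_card UD; have := UD; rewrite (interlace_pt eU) // => /forallP h.
    have [i iD ex] := pt_onto o xD.
    have /andP[_] := h (Ordinal iD); rewrite /= ex => h1.
    have : pt o U i.+1 \in U by apply: pt_mem; rewrite eU.
    by move/(subsetP sU); rewrite inE => h2; rewrite -ltnS (leq_trans h1).
  by rewrite sD IH // ltnW.
case: eqP => [Ur|nUr].
  by rewrite -big_mkcondr -det_binmx_step //; apply: eq_bigl => D; rewrite andbC.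
rewrite big1 // => D /interlace_card eU; case: eqP => // Dr; case: nUr.
by rewrite eU Dr.
Qed.

End DentedDet.

(** * Sums of squared minors *)

Local Open Scope ring_scope.

(** The matrix is the Vandermonde matrix times the triangular matrix of coefficients. *)
Lemma det_polys (R : comRingType) r (q : nat -> {poly R}) (z : nat -> R) :
  (forall j, size (q j) <= j.+1)%N ->
  \det (\matrix_(i < r, j < r) (q j).[z i]) =
  (\prod_(j < r) (q j)`_j) * \det (\matrix_(i < r, j < r) z i ^+ j).
Proof.
move=> size_q; pose C : 'M[R]_r := \matrix_(k, j) (q j)`_k.
have -> : \matrix_(i < r, j < r) (q j).[z i] = (\matrix_(i < r, j < r) z i ^+ j) *m C.
  apply/matrixP=> i j; rewrite !mxE (@horner_coef_wide _ r) ?(leq_trans (size_q j)) //.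
  by apply: eq_bigr => k _; rewrite !mxE mulrC.
rewrite det_mulmx mulrC -[\det C]det_tr det_trig; last first.
  apply/is_trig_mxP=> i j ij; rewrite !mxE nth_default //.
  exact: leq_trans (size_q i) ij.
by congr (_ * _); apply: eq_bigr => j _; rewrite !mxE.
Qed.

Section CauchyBinet.

Variables (R : comRingType) (N r : nat) (o : 'I_N).
Variables (wt : 'I_N -> R) (A : 'I_N -> 'I_r -> R).

Let minor (f : 'I_r -> 'I_N) : R := \det (\matrix_(i, j) A (f i) j).

Lemma injective_image (S : {set 'I_N}) : #|S| = r ->
  [set f | injectiveb (f : {ffun 'I_r -> 'I_N}) && ([set f i | i : 'I_r] == S)] =
  [set [ffun i => pt o S ((s : 'S_r) i)] | s in [set: 'S_r]].
Proof.
move=> Sr; apply/setP=> f; rewrite inE; apply/andP/imsetP => [[/injectiveP f_inj /eqP fS]|].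
  have fi i : f i \in S by rewrite -fS imset_f.
  have ex i : exists k : 'I_r, pt o S k == f i.
    have [k kS e] := pt_onto o (fi i); rewrite Sr in kS.
    by exists (Ordinal kS); rewrite e.
  pose g i := xchoose (ex i); have gE i : pt o S (g i) = f i by apply/eqP/(xchooseP (ex i)).
  have g_inj : injective g by move=> i j e; apply: f_inj; rewrite -!gE e.
  by exists (perm g_inj) => //; apply/ffunP=> i; rewrite ffunE permE gE.
case=> s _ ->; split.
  apply/injectiveP=> i j; rewrite !ffunE => /pt_inj e.
  by apply/(@perm_inj _ s)/ord_inj/e; rewrite Sr.
apply/eqP; rewrite [RHS](pt_image o Sr); apply/setP=> x; apply/imsetP/imsetP => -[i _ ->].
  by exists (s i); rewrite // ffunE.
by exists ((s^-1)%g i); rewrite // ffunE permKV.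
Qed.

(** The weights allow the sets that avoid a point to be selected by a zero weight there. *)
Lemma Cauchy_Binet :
  \sum_(S : {set 'I_N} | #|S| == r) (\prod_(x in S) wt x) * minor (pt o S) ^+ 2 =
  \det (\matrix_(j < r, k < r) \sum_x wt x * A x j * A x k).
Proof.
transitivity (\sum_(f : {ffun 'I_r -> 'I_N}) (\prod_j (wt (f j) * A (f j) j)) * minor f);
  last first.
  under [RHS]eq_bigr => s _.
    under eq_bigr => i _ do rewrite mxE.
    rewrite bigA_distr_bigA /= big_distrr /=.
    over.
  rewrite exchange_big /=; apply: eq_bigr => f _; rewrite /minor /determinant big_distrr /=.
  apply: eq_bigr => s _; rewrite mulrCA; congr (_ * _).
  by rewrite -big_split /=; apply: eq_bigr => i _; rewrite !mxE.
(* A map that is not injective gives a minor with two equal rows. The others are grouped by image,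
   each being the increasing enumeration of its image after a permutation. *)
rewrite [RHS](bigID (fun f : {ffun _ -> _} => injectiveb f)) /= [X in _ + X]big1 ?addr0; last first.
  move=> f /injectivePn[i [j ij e]]; rewrite /minor (determinant_alternate ij) ?mulr0 //.
  by move=> k; rewrite !mxE e.
rewrite (partition_big (fun f : {ffun 'I_r -> 'I_N} => [set f i | i : 'I_r])
  (fun S => #|S| == r)) /=; last first.
  by move=> f /injectiveP f_inj; rewrite card_imset // card_ord.
apply: eq_bigr => S /eqP Sr.
rewrite (eq_bigl (mem [set [ffun i => pt o S ((s : 'S_r) i)] | s in [set: 'S_r]])); last first.
  by move=> f; rewrite -(injective_image Sr) !inE.
rewrite big_imset /=; last first.
  move=> s t _ _ /ffunP e; apply/permP=> i; have := e i; rewrite !ffunE => /pt_inj h.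
  by apply/ord_inj/h; rewrite Sr.
have prod_wt : \prod_(x in S) wt x = \prod_(i < r) wt (pt o S i).
  rewrite {1}(pt_image o Sr) big_imset //= => i j _ _ /pt_inj e.
  by apply/ord_inj/e; rewrite Sr.
have minor_perm (s : 'S_r) :
    minor [ffun i => pt o S (s i)] = (-1) ^+ s * minor (pt o S).
  rewrite /minor -det_perm -det_mulmx -row_permE; congr (\det _).
  by apply/matrixP=> i j; rewrite !mxE ffunE.
rewrite expr2 mulrA mulrC {2}/minor /determinant !mulr_sumr.
(* Inversion turns a permutation of the rows into one of the columns, the form in which
   [determinant] expands. *)
rewrite [RHS](reindex_inj invg_inj) /=; apply: eq_big => [s|s _]; first by rewrite inE.
rewrite minor_perm odd_permV prod_wt big_split /=.
have -> : \prod_(i < r) wt ([ffun i => pt o S ((s^-1)%g i)] i) = \prod_(i < r) wt (pt o S i).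
  rewrite (reindex_inj (@perm_inj _ s)) /=.
  by apply: eq_bigr => i _; rewrite ffunE permK.
have -> : \prod_(i < r) A ([ffun i => pt o S ((s^-1)%g i)] i) i =
    \prod_(i < r) (\matrix_(i, j) A (pt o S i) j : 'M_r) i (s i).
  rewrite (reindex_inj (@perm_inj _ s)) /=.
  by apply: eq_bigr => i _; rewrite ffunE permK mxE.
set P := \prod_(i < r) _ i (s i); move: (minor _) P (\prod_(i < r) _) ((-1) ^+ s).
by move=> a b c d; ring.
Qed.

End CauchyBinet.

(** * Discrete Chebyshev polynomials *)

Section DiscreteChebyshev.

Variable N : nat.
Let nu : rat := N%:R.

(* The points of the uniform weight are [node 0], ..., [node (N - 1)], which   *)
(* are symmetric about 0, so the three-term recurrence has no middle term.    *)
Definition jacobi (k : nat) : rat :=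
  k%:R ^+ 2 * (nu ^+ 2 - k%:R ^+ 2) / (4 * ((2 * k%:R - 1) * (2 * k%:R + 1))).

(** The pair (p_k, p_(k-1)), with p_(-1) = 0. *)
Fixpoint chebyshev_pair (k : nat) : {poly rat} * {poly rat} :=
  if k is k'.+1 then
    let: (p, q) := chebyshev_pair k' in ('X * p - jacobi k' *: q, p)
  else (1, 0).

Definition chebyshev k := (chebyshev_pair k).1.

Lemma chebyshev0 : chebyshev 0 = 1. Proof. by []. Qed.

Lemma chebyshev1 : chebyshev 1 = 'X.
Proof. by rewrite /chebyshev /= mulr1 scaler0 subr0. Qed.

Lemma chebyshevSS k :
  chebyshev k.+2 = 'X * chebyshev k.+1 - jacobi k.+1 *: chebyshev k.
Proof. by rewrite /chebyshev /=; case: (chebyshev_pair k). Qed.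

Lemma chebyshev_monic k :
  (size (chebyshev k) <= k.+1)%N /\ (chebyshev k)`_k = 1.
Proof.
suff [] : ((size (chebyshev k) <= k.+1)%N /\ (chebyshev k)`_k = 1) /\
          ((size (chebyshev k.+1) <= k.+2)%N /\ (chebyshev k.+1)`_k.+1 = 1) by [].
elim: k => [|k [[sk ck] [sk1 ck1]]].
  by rewrite chebyshev0 chebyshev1 size_poly1 size_polyX coef1 coefX.
split=> //; rewrite chebyshevSS; split.
  rewrite (leq_trans (size_polyD _ _)) // size_polyN geq_max; apply/andP; split.
    by rewrite (leq_trans (size_polyMleq _ _)) // size_polyX.
  by rewrite (leq_trans (size_scale_leq _ _)) // (leq_trans sk) // leqW.
rewrite coefB coefXM /= ck1 coefZ nth_default ?mulr0 ?subr0 //.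
exact: leq_trans sk _.
Qed.

Let p k (y : rat) := (chebyshev k).[y].
Let lam (k : nat) : rat := k%:R * (k%:R + 1).
(** [up] and [dn] are the coefficients of p(y+1) - p(y) and p(y-1) - p(y) in the difference operator
    that has the p_k as eigenfunctions. They vanish at the last and at the first node
    respectively. *)
Let up (y : rat) := (y + (nu + 1) / 2) * (y - (nu - 1) / 2).
Let dn (y : rat) := (y + (nu - 1) / 2) * (y - (nu + 1) / 2).
Let shift k y := (4 * k%:R + 2) * p k.+1 y - 2 * k%:R * y * p k y.

Let p0 y : p 0 y = 1. Proof. by rewrite /p chebyshev0 hornerC. Qed.

Let p1 y : p 1 y = y. Proof. by rewrite /p chebyshev1 hornerX. Qed.

Let pSS k y : p k.+2 y = y * p k.+1 y - jacobi k.+1 * p k y.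
Proof. by rewrite /p chebyshevSS hornerD hornerN hornerM hornerX hornerZ. Qed.

Let jacobiE k : jacobi k.+1 = (k%:R + 1) ^+ 2 * (nu ^+ 2 - (k%:R + 1) ^+ 2)
  / (4 * ((2 * k%:R + 1) * (2 * k%:R + 3))).
Proof.
rewrite /jacobi -natr1; congr (_ / (4 * (_ * _))); ring.
Qed.

(** Eliminates [nu] from [up] and [dn], so that the induction step of [shift_rel] is an identity in
    two independent Jacobi coefficients. *)
Let jacobi_rel k : (nu ^+ 2 - 1) / 4 = ((4 * k%:R + 10) * jacobi k.+2
    - (4 * k%:R + 2) * jacobi k.+1 + (k%:R + 1) * (k%:R + 2)) / 2.
Proof.
have k0 : 0 <= k%:R :> rat by [].
have J1 : (4 * k%:R + 2) * jacobi k.+1 =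
      (k%:R + 1) ^+ 2 * (nu ^+ 2 - (k%:R + 1) ^+ 2) / (2 * (2 * k%:R + 3)).
  rewrite jacobiE; move: (nu ^+ 2 - _) => c.
  by field; apply/andP; split; apply: lt0r_neq0; lra.
have J2 : (4 * k%:R + 10) * jacobi k.+2 =
      (k%:R + 2) ^+ 2 * (nu ^+ 2 - (k%:R + 2) ^+ 2) / (2 * (2 * k%:R + 3)).
  rewrite jacobiE -[k.+1%:R]natr1 -[k%:R + 1 + 1]addrA; move: (nu ^+ 2 - _) => c.
  by field; apply/andP; split; apply: lt0r_neq0; lra.
by rewrite J1 J2; field; apply: lt0r_neq0; lra.
Qed.

(* The sum of the two equations is the difference equation of p_k, with       *)
(* eigenvalue lam k. Its induction only closes together with the structure    *)
(* relation, the difference of the two equations, which is the commutator of  *)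
(* the difference operator and of multiplication by y.                        *)
Let shift_rel k y :
  up y * p k (y + 1) = ((lam k + up y + dn y) * p k y + shift k y) / 2 /\
  dn y * p k (y - 1) = ((lam k + up y + dn y) * p k y - shift k y) / 2.
Proof.
elim/ltn_ind: k => -[|[|k]] IH.
- by rewrite /lam /shift !p0 p1 /up /dn; split; field.
- by rewrite /lam /shift pSS !p1 p0 jacobiE /up /dn; split; field.
have [u0 d0] := IH k (ltnW (ltnSn _)); have [u1 d1] := IH k.+1 (ltnSn _).
have step1 : up y * p k.+2 (y + 1) =
    (y + 1) * (up y * p k.+1 (y + 1)) - jacobi k.+1 * (up y * p k (y + 1)).
  by rewrite pSS; ring.
have step2 : dn y * p k.+2 (y - 1) =
    (y - 1) * (dn y * p k.+1 (y - 1)) - jacobi k.+1 * (dn y * p k (y - 1)).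
  by rewrite pSS; ring.
have upE : up y = y ^+ 2 + y - (nu ^+ 2 - 1) / 4 by rewrite /up; field.
have dnE : dn y = y ^+ 2 - y - (nu ^+ 2 - 1) / 4 by rewrite /dn; field.
rewrite step1 step2 u0 u1 d0 d1 /shift !pSS upE dnE (jacobi_rel k) /lam -[k.+2%:R]natr1 -[k.+1%:R]natr1.
move: (p k y) (p k.+1 y) (jacobi k.+1) (jacobi k.+2) (k%:R : rat) => P0 P1 J1 J2 K.
by split; field.
Qed.

Definition node (x : nat) : rat := x%:R - (nu - 1) / 2.

Let nodeS x : node x.+1 = node x + 1.
Proof. by rewrite /node -natr1; ring. Qed.

Let sum_chebyshev k : (0 < k)%N -> \sum_(x < N) p k (node x) = 0.
Proof.
move=> k_gt0; pose g x := dn (node x) * (p k (node x) - p k (node x - 1)).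
(* The difference operator telescopes, and its boundary terms vanish.        *)
have dgE x : g x.+1 - g x = lam k * p k (node x).
  have [u d] := shift_rel k (node x).
  rewrite /g nodeS addrK.
  have -> : dn (node x + 1) = up (node x) by rewrite /dn /up; field.
  rewrite !mulrBr u d; move: (up _) (dn _) (shift _ _) (p k _) (lam k) => U D S P L.
  by field.
have tele n : \sum_(x < n) lam k * p k (node x) = g n - g 0%N.
  elim: n => [|n IH]; first by rewrite big_ord0 subrr.
  by rewrite big_ord_recr /= IH -dgE; ring.
have g0 : g 0%N = 0.
  rewrite /g (_ : dn (node 0) = 0) ?mul0r // /dn /node.
  by rewrite [X in X * _](_ : _ = 0) ?mul0r //; ring.
have gN : g N = 0.
  rewrite /g (_ : dn (node N) = 0) ?mul0r // /dn /node -/nu.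
  by rewrite [X in _ * X](_ : _ = 0) ?mulr0 //; field.
have /eqP := tele N; rewrite g0 gN subr0 -mulr_sumr mulf_eq0 => /orP[|/eqP//].
by rewrite /lam mulf_eq0 natr1 !pnatr_eq0 eqn0Ngt k_gt0.
Qed.

Let form j k := \sum_(x < N) p j (node x) * p k (node x).

Fixpoint sqnorm (k : nat) : rat := if k is k'.+1 then jacobi k * sqnorm k' else nu.

Let form0 k : form 0 k = if k is 0%N then nu else 0.
Proof.
case: k => [|k]; rewrite /form.
  by under eq_bigr do rewrite !p0 mulr1; rewrite sumr_const card_ord.
by under eq_bigr do rewrite p0 mul1r; rewrite sum_chebyshev.
Qed.

Let mul_node k y : y * p k.+1 y = p k.+2 y + jacobi k.+1 * p k y.
Proof. by rewrite pSS subrK. Qed.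

Let form1S k : form 1 k.+1 = form 0 k.+2 + jacobi k.+1 * form 0 k.
Proof.
rewrite /form mulr_sumr -big_split; apply: eq_bigr => x _ /=.
by rewrite p1 mul_node !p0 !mul1r.
Qed.

Let formSS j k :
  form j.+2 k.+1 = form j.+1 k.+2 + jacobi k.+1 * form j.+1 k - jacobi j.+1 * form j k.+1.
Proof.
rewrite /form !mulr_sumr -sumrN -!big_split; apply: eq_bigr => x _ /=.
by rewrite pSS mulrBl mulrAC mul_node; ring.
Qed.

(** Multiplication by y is symmetric for [form], so the recurrence expresses each row of the Gram
    matrix by the two before it; row 0 is [sum_chebyshev]. *)
Let form_ge j : (forall k, (j < k)%N -> form j k = 0) /\ form j j = sqnorm j.
Proof.
elim/ltn_ind: j => -[|[|j]] IH.
- by split=> [[|k]|]; rewrite ?form0.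
- by split=> [[|[|k]]|] //; rewrite form1S !form0 ?mulr0 add0r.
have [z0 _] := IH j (ltnW (ltnSn _)); have [z1 h1] := IH j.+1 (ltnSn _).
split=> [[|k] // jk|]; rewrite formSS.
  by rewrite !z1 ?z0 ?mulr0 ?addr0 ?subr0 //; lia.
by rewrite z1 ?z0 ?h1 ?mulr0 ?subr0 ?add0r //; lia.
Qed.

Lemma chebyshev_orthogonal j k :
  \sum_(x < N) (chebyshev j).[node x] * (chebyshev k).[node x] =
  if j == k then sqnorm j else 0.
Proof.
case: (ltngtP j k) => [jk|kj|->].
- exact: (proj1 (form_ge j)).
- by under eq_bigr do rewrite mulrC; exact: (proj1 (form_ge k)).
- exact: (proj2 (form_ge k)).
Qed.

Lemma jacobi_gt0 k : (0 < k < N)%N -> 0 < jacobi k.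
Proof.
case/andP=> k0 kN; have k1 : 1 <= k%:R :> rat by rewrite ler1n.
have kn : k%:R + 1 <= nu by rewrite natr1 ler_nat.
rewrite /jacobi; apply: divr_gt0; last by nra.
by apply: mulr_gt0; nra.
Qed.

Lemma sqnorm_gt0 k : (k < N)%N -> 0 < sqnorm k.
Proof.
elim: k => [|k IH] kN; first by rewrite ltr0n.
by rewrite /= mulr_gt0 ?jacobi_gt0 ?IH // ltnW.
Qed.

Lemma chebyshev_odd0 k : (chebyshev k.*2.+1).[0] = 0.
Proof.
elim: k => [|k IH]; first exact: p1.
by rewrite doubleS; have := pSS k.*2.+1 0; rewrite mul0r /p IH mulr0 subr0.
Qed.

Lemma chebyshev_even0 k :
  (chebyshev k.*2.+2).[0] = - jacobi k.*2.+1 * (chebyshev k.*2).[0].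
Proof. by have := pSS k.*2 0; rewrite mul0r /p sub0r mulNr. Qed.

End DiscreteChebyshev.

(** * The number of centered tilings *)

Lemma det_diag_rank1 (F : fieldType) r (d v : 'I_r -> F) : (forall i, d i != 0) ->
  \det (\matrix_(i, j) ((if i == j then d i else 0) - v i * v j)) =
  (\prod_i d i) * (1 - \sum_i v i ^+ 2 / d i).
Proof.
move=> d0; pose D : 'M[F]_r := diag_mx (\row_i d i).
pose V : 'rV[F]_r := \row_i v i; pose W : 'rV[F]_r := \row_i (v i / d i).
have -> : \matrix_(i, j) ((if i == j then d i else 0) - v i * v j) = D - V^T *m V.
  apply/matrixP=> i j; rewrite !mxE big_ord1 !mxE; congr (_ - _).
  by case: eqP => [->|_]; rewrite ?mulr1n ?mulr0n.
have WD : W *m D = V.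
  by apply/rowP=> j; rewrite mul_mx_diag !mxE divfK.
have WV : W *m V^T = (\sum_i v i ^+ 2 / d i)%:M.
  apply/matrixP=> i j; rewrite !ord1 !mxE eqxx mulr1n.
  by apply: eq_bigr => k _; rewrite !mxE expr2 mulrAC.
(* Both block eliminations of M give its determinant.                        *)
pose M := block_mx (1%:M : 'M_1) V V^T D.
have e1 : M = block_mx 1%:M 0 V^T 1%:M *m block_mx 1%:M V 0 (D - V^T *m V).
  by rewrite mulmx_block !mul1mx !mulmx1 ?mul0mx ?mulmx0 !addr0 addrC subrK.
have e2 : M = block_mx 1%:M W 0 1%:M *m
    block_mx (1 - \sum_i v i ^+ 2 / d i)%:M 0 V^T D.
  rewrite mulmx_block !mul1mx ?mulmx1 ?mul0mx ?mulmx0 !add0r WD WV.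
  by rewrite -raddfD subrK.
have := congr1 determinant e1; rewrite {1}e2 !det_mulmx !det_ublock !det_lblock.
rewrite !det1 !mul1r det_scalar1 det_diag => <-.
by rewrite mulrC; congr (_ * _); apply: eq_bigr => i _; rewrite mxE.
Qed.

Lemma prod_linear_coef (R : comRingType) (u v : nat -> R) j :
  let q := \prod_(l < j) (u l *: 'X + (v l)%:P) in
  (size q <= j.+1)%N /\ q`_j = \prod_(l < j) u l.
Proof.
elim: j => [|j [IHs IHc]] /=; first by rewrite !big_ord0 size_poly1 coef1.
rewrite !big_ord_recr /=; split.
  apply: leq_trans (size_polyMleq _ _) _.
  have : (size (u j *: 'X + (v j)%:P)%R <= 2)%N.
    rewrite (leq_trans (size_polyD _ _)) // geq_max.
    rewrite (leq_trans (size_scale_leq _ _)) ?size_polyX //.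
    by rewrite (leq_trans (size_polyC_leq1 _)).
  by move=> s2; rewrite -subn1 leq_subLR (leq_trans (leq_add IHs s2)) // addn2.
rewrite mulrDr -scalerAr coefD coefZ coefMX /= IHc coefMC nth_default //.
by rewrite mul0r addr0 mulrC.
Qed.

Lemma bin_prod (n j : nat) : 'C(n, j)%:R = \prod_(l < j) ((n%:R - l%:R) / l.+1%:R) :> rat.
Proof.
elim: j => [|j IH]; first by rewrite big_ord0 bin0.
rewrite big_ord_recr /= -IH; have j0 : j.+1%:R != 0 :> rat by rewrite pnatr_eq0.
apply: (mulIf j0); rewrite mulrA divfK // -natrM mulnC mul_bin_left natrM mulrC.
have [jn|nj] := leqP j n; first by rewrite natrB.
by rewrite bin_small // !mul0r.
Qed.

Section CenteredCount.

Variables (N : nat) (o : 'I_N).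

Definition cheb_minor r (S : {set 'I_N}) : rat :=
  \det (\matrix_(i < r, j < r) (chebyshev N j).[node N (pt o S i)]).

Lemma cheb_minorE r (S : {set 'I_N}) :
  cheb_minor r S = \det (\matrix_(i < r, j < r) node N (pt o S i) ^+ j).
Proof.
rewrite /cheb_minor (det_polys _ (fun i => node N (pt o S i))); last first.
  by move=> j; have [] := chebyshev_monic N j.
by rewrite big1 ?mul1r // => j _; have [] := chebyshev_monic N j.
Qed.

(** 'C(n, j) is a polynomial in n with leading term n^j / j!. The slope [e] is 1 for [S] and -1 for
    its mirror image; absolute values discard the signs. *)
Lemma norm_det_linear_bin r (S : {set 'I_N}) (e : rat) (n : nat -> nat) : `|e| = 1 ->
  (forall i, (n i)%:R = e * node N (pt o S i) + (N%:R - 1) / 2) ->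
  `|\det (\matrix_(i < r, j < r) 'C(n i, j)%:R : 'M[rat]_r)| =
  (\prod_(j < r) (j`!%:R)^-1) * `|cheb_minor r S|.
Proof.
move=> e1 nE; pose u l : rat := e / l.+1%:R.
pose v l : rat := ((N%:R - 1) / 2 - l%:R) / l.+1%:R.
pose q j := \prod_(l < j) (u l *: 'X + (v l)%:P).
have -> : \matrix_(i < r, j < r) 'C(n i, j)%:R =
          \matrix_(i < r, j < r) (q j).[node N (pt o S i)].
  apply/matrixP=> i j; rewrite !mxE bin_prod horner_prod; apply: eq_bigr => l _.
  rewrite hornerD hornerZ hornerX hornerC nE /u /v; ring.
rewrite (det_polys _ (fun i => node N (pt o S i))); last first.
  by move=> j; have [] := prod_linear_coef u v j.
rewrite -cheb_minorE normrM; congr (_ * _); rewrite normr_prod; apply: eq_bigr => j _.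
have [_ ->] := prod_linear_coef u v j; rewrite normr_prod.
under eq_bigr do rewrite /u normrM e1 mul1r normfV normr_nat.
by rewrite prodfV -natr_prod fact_prod big_add1 big_mkord.
Qed.

Lemma pt_rev r (S : {set 'I_N}) (i : 'I_r) : #|S| = r ->
  pt o (@rev_ord N @: S) i = rev_ord (pt o S (rev_ord i)).
Proof.
move=> Sr; pose f (k : 'I_r) := rev_ord (pt o S (rev_ord k)).
have f_incr : {homo f : k l / (k < l)%N}.
  move=> k l kl; rewrite /f /= ltn_sub2lE //.
  by rewrite ltnS; apply: pt_lt; rewrite ?Sr /=; have := ltn_ord l; lia.
rewrite -/(f i); have [_ <-] := pt_incr o f_incr; congr (pt o _ _); apply/setP=> x.
apply/imsetP/imsetP => [[y yS ->]|[k _ ->]].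
  have [k kr e] := pt_onto o yS; rewrite Sr in kr.
  by exists (rev_ord (Ordinal kr)) => //; rewrite /f rev_ordK /= e.
by exists (pt o S (rev_ord k)) => //; apply: pt_mem; rewrite Sr.
Qed.

Lemma norm_det_binmx r (S : {set 'I_N}) :
  `|\det (binmx r (pt o S))| = (\prod_(j < r) (j`!%:R)^-1) * `|cheb_minor r S|.
Proof.
apply: (@norm_det_linear_bin r S 1 (fun i => pt o S i)) => [|i]; first by rewrite normr1.
by rewrite /node; ring.
Qed.

Lemma norm_det_binmx_rev r (S : {set 'I_N}) : #|S| = r ->
  `|\det (binmx r (pt o (@rev_ord N @: S)))| =
  (\prod_(j < r) (j`!%:R)^-1) * `|cheb_minor r S|.
Proof.
move=> Sr; rewrite -(@norm_det_linear_bin r S (-1) (fun i => rev_ord (pt o S i))).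
(* Mirroring also reverses the enumeration of the set, which permutes the rows of [M]. *)
- pose M : 'M[rat]_r := \matrix_(i, j) 'C(rev_ord (pt o S i), j)%:R.
  have -> : binmx r (pt o (@rev_ord N @: S)) = row_perm (perm (@rev_ord_inj r)) M.
    by apply/matrixP=> i j; rewrite !mxE permE pt_rev.
  by rewrite row_permE det_mulmx det_perm normrM normrX normrN1 expr1n mul1r.
- by rewrite normrN1.
move=> i; rewrite /= natrB; last exact: ltn_ord.
by rewrite -natr1 /node; field.
Qed.

Hypothesis oE : (o.*2.+1 = N)%N.

Lemma node_center : node N o = 0.
Proof.
have eN : N%:R = o%:R * 2 + 1 :> rat by rewrite -[in LHS]oE -natr1 -muln2 natrM.
by rewrite /node eN; field.
Qed.

Lemma sum_cheb_minor r : (r <= N)%N ->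
  \sum_(S : {set 'I_N} | (o \in S) && (#|S| == r)) cheb_minor r S ^+ 2 =
  (\prod_(j < r) sqnorm N j) * \sum_(j < r) (chebyshev N j).[0] ^+ 2 / sqnorm N j.
Proof.
(* Subtract from the sum over all S the sum over the S that avoid o.         *)
move=> rN; pose A (x : 'I_N) (j : 'I_r) := (chebyshev N j).[node N x].
have all_sets := Cauchy_Binet o (fun _ => 1) A.
have avoiding := Cauchy_Binet o (fun x => (x != o)%:R) A.
have -> : \sum_(S : {set 'I_N} | (o \in S) && (#|S| == r)) cheb_minor r S ^+ 2 =
   \sum_(S : {set 'I_N} | #|S| == r) (\prod_(x in S) 1) * cheb_minor r S ^+ 2
 - \sum_(S : {set 'I_N} | #|S| == r) (\prod_(x in S) (x != o)%:R) * cheb_minor r S ^+ 2.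
  rewrite -sumrB big_mkcondl; apply: eq_bigr => S _.
  rewrite big1 // mul1r; case: ifP => oS.
    by rewrite (bigD1 o) //= eqxx mul0r mul0r subr0.
  rewrite big1 ?mul1r ?subrr // => x xS; case: eqP => // xo.
  by rewrite -xo xS in oS.
rewrite all_sets avoiding.
have gram (j k : 'I_r) : \sum_x A x j * A x k = if j == k then sqnorm N j else 0.
  by rewrite chebyshev_orthogonal.
have h0 (j : 'I_r) : sqnorm N j != 0.
  by apply: lt0r_neq0; apply: sqnorm_gt0; apply: leq_trans rN.
have -> : \matrix_(j, k) \sum_x (x != o)%:R * A x j * A x k =
    \matrix_(j, k) ((if j == k then sqnorm N j else 0) -
      (chebyshev N j).[0] * (chebyshev N k).[0]).
  apply/matrixP=> j k; rewrite !mxE -gram [in RHS](bigD1 o) //= /A node_center.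
  rewrite addrC addrK [LHS](bigD1 o) //= eqxx !mul0r add0r.
  by apply: eq_bigr => x ->; rewrite mul1r.
have -> : \matrix_(j, k) \sum_x 1 * A x j * A x k = diag_mx (\row_(j < r) sqnorm N j).
  apply/matrixP=> j k; rewrite !mxE; under eq_bigr do rewrite mul1r.
  by rewrite gram; case: eqP => [->|_]; rewrite ?mulr1n ?mulr0n.
rewrite det_diag (@det_diag_rank1 _ _ (fun j : 'I_r => sqnorm N j)
  (fun j : 'I_r => (chebyshev N j).[0])) //.
under eq_bigr do rewrite mxE.
by rewrite mulrBr mulr1 opprB addrC subrK.
Qed.

End CenteredCount.

(** The two halves give the same minor up to sign. Counts are nonnegative, so absolute values may be
    taken, and the product is a square. *)
Lemma card_centered_tilings_sqnorm (a c : nat) (o : 'I_(a + c)) :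
  (0 < a)%N -> (o.*2.+1 = a + c)%N ->
  #|centered_tilings a a c|%:R =
  (\prod_(j < a) (sqnorm (a + c) j / j`!%:R ^+ 2)) *
  \sum_(j < a) (chebyshev (a + c) j).[0] ^+ 2 / sqnorm (a + c) j.
Proof.
move=> a0 oE; rewrite (card_centered_tilings oE) // natr_sum.
have eN : ((a + c).-1 - c).+1 = a by lia.
have cN : (c <= (a + c).-1)%N by lia.
have NN : ((a + c).-1 < a + c)%N by lia.
have sub (S : {set 'I_(a + c)}) : S \subset below (a + c) (a + c).-1.
  by apply/subsetP=> x _; rewrite inE; have := ltn_ord x; lia.
pose ifact : rat := \prod_(j < a) (j`!%:R)^-1.
transitivity (\sum_(S : {set 'I_(a + c)} | (o \in S) && (#|S| == a))
   ifact ^+ 2 * cheb_minor o a S ^+ 2).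
  rewrite big_mkcondr; apply: eq_bigr => S _; rewrite natrM.
  rewrite -[(dented _ _ S)%:R]ger0_norm ?ler0n //.
  rewrite -[(dented _ _ (_ @: S))%:R]ger0_norm ?ler0n //.
  rewrite !(dented_det o cN NN (sub _)) eN card_imset; last exact: rev_ord_inj.
  case: eqP => [Sa|_]; last by rewrite normr0 mul0r.
  rewrite norm_det_binmx norm_det_binmx_rev // -/ifact mulrACA -normrM.
  by rewrite -!expr2 ger0_norm // sqr_ge0.
rewrite -mulr_sumr sum_cheb_minor // ?leq_addr // mulrA; congr (_ * _).
rewrite big_split /= mulrC; congr (_ * _); rewrite /ifact -prodrXl.
by apply: eq_bigr => j _; rewrite exprVn.
Qed.

(** * MacMahon's product *)

(** Drives the induction on the height c, since N = a + c. *)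
Lemma sqnormS N j : (j < N)%N ->
  sqnorm N.+1 j = sqnorm N j * ((N.+1 + j)%:R / (N - j)%:R).
Proof.
move=> jN; rewrite natrB ?(ltnW jN) // natrD -natr1.
elim: j jN => [|j IH] jN.
  have N0 : N%:R != 0 :> rat by rewrite pnatr_eq0 -lt0n.
  by rewrite /= addr0 subr0 mulrC divfK // natr1.
rewrite [LHS]/= [sqnorm N j.+1]/= IH ?(ltnW jN) // /jacobi -[N.+1%:R]natr1 -[j.+1%:R]natr1.
have j0 : 0 <= j%:R :> rat by [].
have jn : j%:R + 1 < N%:R :> rat by rewrite natr1 ltr_nat.
move: (sqnorm N j) (j%:R : rat) (N%:R : rat) j0 jn => s J n j0 jn {IH jN N j}.
have J1 : 2 * (J + 1) - 1 != 0 by lra.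
have J3 : 2 * (J + 1) + 1 != 0 by lra.
by field; repeat (apply/andP; split); lra.
Qed.

Lemma prod_ratio a c : \prod_(1 <= i < a.+1) ((i + c + a)%:R / (i + c)%:R : rat) =
  \prod_(j < a) (((a + c).+1 + j)%:R / (a + c - j)%:R).
Proof.
rewrite !prodf_div; congr (_ / _).
  by rewrite big_add1 /= big_mkord; apply: eq_bigr => j _; congr (_%:R); lia.
rewrite big_add1 /= big_mkord [RHS](reindex_inj rev_ord_inj) /=.
by apply: eq_bigr => j _; congr (_%:R); have := ltn_ord j; lia.
Qed.

Lemma P_height0 a b : P a b 0 = 1.
Proof. by rewrite /P big1 // => i _; rewrite big1 // => j _; rewrite big_geq. Qed.

(** In the new layer, k = c + 1, the product over j telescopes. *)
Lemma P_heightS a c : P a a c.+1 = P a a c * \prod_(1 <= i < a.+1) ((i + c + a)%:R / (i + c)%:R).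
Proof.
rewrite /P -big_split /=; apply: eq_big_nat => i /andP[i0 _].
have -> : (i + c + a)%:R / (i + c)%:R =
    \prod_(1 <= j < a.+1) ((i + c + j)%:R / (i + c + j - 1)%:R) :> rat.
  elim: a => [|b IH]; first by rewrite big_geq // addn0 divff // pnatr_eq0; lia.
  rewrite big_nat_recr //= -IH addnS subn1 /=.
  have h : (i + c + b)%:R != 0 :> rat by rewrite pnatr_eq0; lia.
  by rewrite [RHS]mulrC [RHS]mulrA divfK.
rewrite -big_split; apply: eq_big_nat => j /andP[j0 _] /=.
rewrite big_nat_recr //=; congr (_ * (_ / _)).
  by rewrite (_ : (i + j + c.+1 = (i + c + j).+1)%N) -?natr1 ?addrK //; lia.
by rewrite (_ : (i + j + c.+1 = (i + c + j - 1) + 2)%N) ?natrD ?addrK //; lia.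
Qed.

Lemma sqnorm_last a : sqnorm a.+1 a = a`!%:R ^+ 4 / (2 * a)`!%:R.
Proof.
elim: a => [|a IH]; first by rewrite /= divr1.
have -> : sqnorm a.+2 a.+1 = jacobi a.+2 a.+1 * sqnorm a.+2 a by [].
rewrite sqnormS // IH subSnn (_ : (2 * a.+1)%N = (2 * a).+2); last lia.
rewrite (_ : (a.+2 + a)%N = (2 * a).+2); last lia.
rewrite !factS !natrM /jacobi.
rewrite -[(2 * a).+2%:R]natr1 -[(2 * a).+1%:R]natr1 -[a.+2%:R]natr1 -[a.+1%:R]natr1 natrM.
have f0 : (2 * a)`!%:R != 0 :> rat by rewrite pnatr_eq0 -lt0n fact_gt0.
have a0 : 0 <= a%:R :> rat by [].
move: ((2 * a)`!%:R : rat) f0 (a`!%:R : rat) (a%:R : rat) a0 {IH} => f f0 g A a0.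
have A1 : 2 * (A + 1) - 1 != 0 by lra.
have A3 : 2 * (A + 1) + 1 != 0 by lra.
have A2 : 2 * A + 1 + 1 != 0 by lra.
have A4 : 2 * A + 1 != 0 by lra.
by field; rewrite ?f0 ?A1 ?A2 ?A3 ?A4.
Qed.

(** From a to a + 1, the old factors are multiplied by 'C(2a, a) in total, and the new factor is its
    inverse. *)
Lemma prod_sqnorm0 a : \prod_(j < a) (sqnorm a j / j`!%:R ^+ 2) = 1.
Proof.
elim: a => [|a IH]; first by rewrite big_ord0.
rewrite big_ord_recr /= sqnorm_last.
under eq_bigr => j _ do rewrite sqnormS // mulrAC.
rewrite big_split /= IH mul1r prodf_div.
have e1 b : \prod_(j < b) (a.+1 + j)%:R * a`!%:R = (a + b)`!%:R :> rat.
  elim: b => [|b IHb]; first by rewrite big_ord0 mul1r addn0.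
  by rewrite big_ord_recr /= mulrAC IHb addnS factS natrM mulrC addSn.
have e2 : \prod_(j < a) (a - j)%:R = a`!%:R :> rat.
  by rewrite -natr_prod -ffact_prod ffactnn.
have fa : a`!%:R != 0 :> rat by rewrite pnatr_eq0 -lt0n fact_gt0.
have f2 : (2 * a)`!%:R != 0 :> rat by rewrite pnatr_eq0 -lt0n fact_gt0.
have := e1 a; rewrite addnn -mul2n e2 => <-.
have p0 : \prod_(j < a) (a.+1 + j)%:R != 0 :> rat.
  by rewrite -natr_prod pnatr_eq0 -lt0n prodn_gt0.
by field; rewrite fa p0.
Qed.

Lemma prod_sqnorm a c : \prod_(j < a) (sqnorm (a + c) j / j`!%:R ^+ 2) = P a a c.
Proof.
elim: c => [|c IH]; first by rewrite addn0 prod_sqnorm0 P_height0.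
rewrite P_heightS -IH prod_ratio -big_split /=; apply: eq_bigr => j _.
have ja : (j < a + c)%N by rewrite (leq_trans (ltn_ord j)) ?leq_addr.
by rewrite addnS (sqnormS ja) mulrAC.
Qed.

(** * The density at the center *)

Section CenterDensity.

Variable M : nat.
Hypothesis M_gt0 : (0 < M)%N.

(** With [M] = m + n fixed, neither [alpha] nor the weight on N = 2M - 1 points depends on n, and
    [pre n * S n] is Q (M - n) n. *)
Let alpha i : rat := shifted_fact (M - i)%N%:R (2 * i)%N / i`!%:R ^+ 2.

Let S n : rat := \sum_(0 <= i < n) ((-1) ^+ (n - i - 1)%N / (2 * n - 2 * i - 1)%N%:R * alpha i).

Let pre n : rat := ((2 * n)%N`!%:R ^+ 2 * (2 * (M - n))%N`!%:R * (M + n - 1)%N`!%:R)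
     / (2 * n`!%:R ^+ 2 * (M - n)%N`!%:R * (2 * M + 2 * n - 2)%N`!%:R).

Let cc (n : nat) : rat := (2 * M%:R - 2 * n%:R - 1) * (2 * M%:R + 2 * n%:R - 1).

Let alpha0 : alpha 0 = 1.
Proof. by rewrite /alpha /shifted_fact muln0 big_ord0 fact0 expr1n divr1. Qed.

Let alphaS i : (i < M)%N ->
  alpha i.+1 = alpha i * ((M%:R - i%:R - 1) * (M%:R + i%:R) / (i%:R + 1) ^+ 2).
Proof.
move=> iM; rewrite /alpha /shifted_fact.
have -> : (2 * i.+1)%N = (2 * i).+2 by lia.
rewrite big_ord_recl big_ord_recr /= addr0.
have -> : \prod_(l < 2 * i) ((M - i.+1)%:R + (bump 0 l)%:R) =
          \prod_(l < 2 * i) ((M - i)%:R + l%:R) :> rat.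
  by apply: eq_bigr => l _; rewrite -!natrD; congr (_%:R); rewrite /bump /=; lia.
have -> : (M - i.+1)%:R + (bump 0 (2 * i))%:R = M%:R + i%:R :> rat.
  by rewrite -!natrD; congr (_%:R); rewrite /bump /=; lia.
rewrite natrB // -natr1 opprD addrA factS natrM -natr1.
have f0 : i`!%:R != 0 :> rat by rewrite pnatr_eq0 -lt0n fact_gt0.
have i1 : i%:R + 1 != 0 :> rat by rewrite natr1 pnatr_eq0.
move: (\prod_(l < _) _) => p.
by field; rewrite f0 i1.
Qed.

(* Creative telescoping; the certificate is G below.                         *)
Let S_rec n : (n <= M)%N ->
  (2 * n%:R + 1) ^+ 2 * S n.+1 - cc n * S n = (4 * n%:R + 1) * alpha n.
Proof.
move=> nM; pose G i : rat :=
  -4 * ((-1) ^+ (n - i)%N * alpha i * i%:R ^+ 2 / (2 * n%:R + 1 - 2 * i%:R)).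
have step i : (0 <= i < n)%N ->
    (2 * n%:R + 1) ^+ 2 * ((-1) ^+ (n.+1 - i - 1)%N / (2 * n.+1 - 2 * i - 1)%N%:R * alpha i)
    - cc n * ((-1) ^+ (n - i - 1)%N / (2 * n - 2 * i - 1)%N%:R * alpha i)
    = G i.+1 - G i.
  move=> /= i_n; rewrite /G alphaS; last exact: leq_trans nM.
  have [d ed] : exists d, n = (i + d).+1 by exists (n - i.+1)%N; lia.
  have -> : (n.+1 - i - 1 = d.+1)%N by lia.
  have -> : (n - i - 1 = d)%N by lia.
  have -> : (n - i = d.+1)%N by lia.
  have -> : (n - i.+1 = d)%N by lia.
  have -> : (2 * n.+1 - 2 * i - 1 = 2 * d + 3)%N by lia.
  have -> : (2 * n - 2 * i - 1 = 2 * d + 1)%N by lia.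
  rewrite [(-1) ^+ d.+1]exprS /cc ed -[(i + d).+1%:R]natr1 -[i.+1%:R]natr1 [(2 * d + 3)%:R]natrD
    [(2 * d + 1)%:R]natrD [(i + d)%:R]natrD [(2 * d)%:R]natrM.
  have d0 : 0 <= d%:R :> rat by [].
  have i0 : 0 <= i%:R :> rat by [].
  move: (alpha i) ((-1) ^+ d : rat) (d%:R : rat) (i%:R : rat) (M%:R : rat) d0 i0 {ed i_n}.
  move=> a s D I m D0 I0.
  have D1 : 2 * D + 1 != 0 by lra.
  have D3 : 2 * D + 3 != 0 by lra.
  have I1 : I + 1 != 0 by lra.
  have E1 : 2 * (I + D + 1) + 1 - 2 * (I + 1) != 0 by lra.
  have E2 : 2 * (I + D + 1) + 1 - 2 * I != 0 by lra.
  by field; rewrite ?D1 ?D3 ?I1 ?E1 ?E2.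
rewrite /S big_nat_recr //= mulrDr addrAC !mulr_sumr -sumrB.
rewrite (eq_big_nat _ _ step) telescope_sumr // /G subnn.
have -> : (n.+1 - n - 1 = 0)%N by lia.
have -> : (2 * n.+1 - 2 * n - 1 = 1)%N by lia.
have -> : 2 * n%:R + 1 - 2 * n%:R = 1 :> rat by ring.
by rewrite !expr0 expr0n /= mulr0 mul0r mulr0 subr0; field.
Qed.

Let preS n : (n < M)%N -> pre n.+1 = pre n * ((2 * n%:R + 1) ^+ 2 / cc n).
Proof.
move=> nM; rewrite /pre.
have [d ed] : exists d, M = (n + d).+1 by exists (M - n.+1)%N; lia.
have -> : (M - n = d.+1)%N by lia.
have -> : (M - n.+1 = d)%N by lia.
have -> : (2 * n.+1 = (2 * n).+2)%N by lia.
have -> : (2 * d.+1 = (2 * d).+2)%N by lia.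
have -> : (M + n.+1 - 1 = (2 * n + d).+1)%N by lia.
have -> : (M + n - 1 = 2 * n + d)%N by lia.
have -> : (2 * M + (2 * n).+2 - 2 = (4 * n + 2 * d).+2)%N by lia.
have -> : (2 * M + 2 * n - 2 = 4 * n + 2 * d)%N by lia.
rewrite !factS !natrM /cc ed.
have f0 k : k`!%:R != 0 :> rat by rewrite pnatr_eq0 -lt0n fact_gt0.
rewrite -[(2 * n).+2%:R]natr1 -[(2 * n).+1%:R]natr1 -[(2 * d).+2%:R]natr1.
rewrite -[(2 * d).+1%:R]natr1 -[d.+1%:R]natr1 -[n.+1%:R]natr1.
rewrite -[(4 * n + 2 * d).+2%:R]natr1 -[(4 * n + 2 * d).+1%:R]natr1.
rewrite -[(2 * n + d).+1%:R]natr1 -[(n + d).+1%:R]natr1 [(n + d)%:R]natrD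
  [(2 * n + d)%:R]natrD [(4 * n + 2 * d)%:R]natrD [(2 * n)%:R]natrM [(2 * d)%:R]natrM
  [(4 * n)%:R]natrM.
have d0 : 0 <= d%:R :> rat by [].
have n0 : 0 <= n%:R :> rat by [].
move: (f0 (2 * n)%N) (f0 n) (f0 (2 * d)%N) (f0 d) (f0 (2 * n + d)%N) (f0 (4 * n + 2 * d)%N).
move: ((2 * n)`!%:R : rat) (n`!%:R : rat) ((2 * d)`!%:R : rat) (d`!%:R : rat).
move: ((2 * n + d)`!%:R : rat) ((4 * n + 2 * d)`!%:R : rat) (n%:R : rat) (d%:R : rat) n0 d0.
move=> f5 f6 n' d' n0 d0 f1 f2 f3 f4 h1 h2 h3 h4 h5 h6.
clear ed nM.
have D1 : d' + 1 != 0 by lra.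
have N1 : n' + 1 != 0 by lra.
have D2 : 2 * d' + 1 != 0 by lra.
have E1 : 4 * n' + 2 * d' + 1 + 1 != 0 by lra.
have E2 : 4 * n' + 2 * d' + 1 != 0 by lra.
have E3 : 2 * (n' + d' + 1) - 2 * n' - 1 != 0 by lra.
have E4 : 2 * (n' + d' + 1) + 2 * n' - 1 != 0 by lra.
by field; rewrite ?h1 ?h2 ?h3 ?h4 ?h5 ?h6 ?D1 ?N1 ?D2 ?E1 ?E2 ?E3 ?E4.
Qed.

Let cc_neq0 n : (n < M)%N -> cc n != 0.
Proof.
move=> nM; rewrite /cc; have n0 : 0 <= n%:R :> rat by [].
have nm : n%:R + 1 <= M%:R :> rat by rewrite natr1 ler_nat.
by rewrite mulf_neq0 //; lra.
Qed.

Let pre0 : pre 0 = 2 * M%:R - 1.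
Proof.
rewrite /pre; have [d ed] : exists d, M = d.+1 by exists M.-1; lia.
rewrite subn0 muln0 fact0 addn0 (_ : (2 * M)%N = (2 * d).+2); last lia.
rewrite (_ : (M - 1 = d)%N); last lia.
rewrite (_ : ((2 * d).+2 + 0 - 2 = 2 * d)%N); last lia.
rewrite ed !factS [((2 * d).+2 * _)%:R]natrM [((2 * d).+1 * _)%:R]natrM [(d.+1 * _)%:R]natrM.
rewrite -[(2 * d).+2%:R]natr1 -[(2 * d).+1%:R]natr1 -[d.+1%:R]natr1 [(2 * d)%:R]natrM.
have f0 k : k`!%:R != 0 :> rat by rewrite pnatr_eq0 -lt0n fact_gt0.
have d0 : 0 <= d%:R :> rat by [].
have d1 : d%:R + 1 != 0 :> rat by rewrite natr1 pnatr_eq0.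
move: (f0 (2 * d)%N) (f0 d); move: ((2 * d)`!%:R : rat) (d`!%:R : rat) => f g h1 h2.
by field; rewrite h1 h2 d1.
Qed.

Let N := (2 * M - 1)%N.

Let NE : N%:R = 2 * M%:R - 1 :> rat.
Proof. by rewrite /N natrB ?natrM //; lia. Qed.

Let term n := (chebyshev N n).[0] ^+ 2 / sqnorm N n.

Let termS n : (n.+1 < M)%N ->
  term n.+1.*2 = term n.*2 * (jacobi N n.*2.+1 / jacobi N n.*2.+2).
Proof.
move=> nM; rewrite /term doubleS chebyshev_even0.
have -> : sqnorm N n.*2.+2 = jacobi N n.*2.+2 * (jacobi N n.*2.+1 * sqnorm N n.*2) by [].
have j1 : jacobi N n.*2.+1 != 0.
  by apply/lt0r_neq0/jacobi_gt0; rewrite /N; lia.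
have j2 : jacobi N n.*2.+2 != 0.
  by apply/lt0r_neq0/jacobi_gt0; rewrite /N; lia.
have s0 : sqnorm N n.*2 != 0.
  by apply/lt0r_neq0/sqnorm_gt0; rewrite /N; lia.
move: (jacobi _ _) (jacobi _ _) (sqnorm _ _) _.[0] j1 j2 s0 => J1 J2 s p h1 h2 h3.
by field; rewrite h1 h2 h3.
Qed.

(** Both sides are 1 / (2M - 1) at n = 0 and have the same ratio of consecutive values, by [termS]
    on one side and by [preS] and [alphaS] on the other. *)
Let termE n : (n < M)%N -> pre n * ((4 * n%:R + 1) * alpha n / cc n) = term n.*2.
Proof.
elim: n => [|n IH] nM.
  rewrite /term chebyshev0 hornerC pre0 alpha0 /cc /= NE expr1n.
  have M1 : 1 <= M%:R :> rat by rewrite ler1n.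
  have h : 2 * M%:R - 1 != 0 :> rat by lra.
  by move: (M%:R : rat) h => m h; field; rewrite ?subr0 ?addr0 h.
rewrite termS // -IH ?(ltnW nM) // preS ?(ltnW nM) // alphaS ?(ltnW nM) //.
have c0 := cc_neq0 (ltnW nM).
have j1 : jacobi N n.*2.+1 = (2 * n%:R + 1) ^+ 2 * (M%:R - n%:R - 1) * (M%:R + n%:R) /
    ((4 * n%:R + 1) * (4 * n%:R + 3)).
  rewrite /jacobi NE -natr1 -muln2 natrM; have n0 : 0 <= n%:R :> rat by [].
  move: (M%:R : rat) (n%:R : rat) n0 => m k k0 {IH}.
  have K1 : 2 * (k * 2 + 1) - 1 != 0 by lra.
  have K3 : 2 * (k * 2 + 1) + 1 != 0 by lra.
  have K1' : 4 * k + 1 != 0 by lra.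
  have K3' : 4 * k + 3 != 0 by lra.
  by field; rewrite ?K1 ?K3 ?K1' ?K3'.
have j2 : jacobi N n.*2.+2 = (n%:R + 1) ^+ 2 * cc n.+1 / ((4 * n%:R + 3) * (4 * n%:R + 5)).
  rewrite /jacobi NE /cc -[n.*2.+2%:R]natr1 -[n.*2.+1%:R]natr1 -[n.+1%:R]natr1 -muln2 natrM.
  have n0 : 0 <= n%:R :> rat by [].
  move: (M%:R : rat) (n%:R : rat) n0 => m k k0 {IH j1}.
  have K1 : 2 * (k * 2 + 1 + 1) - 1 != 0 by lra.
  have K3 : 2 * (k * 2 + 1 + 1) + 1 != 0 by lra.
  have K1' : 4 * k + 5 != 0 by lra.
  have K3' : 4 * k + 3 != 0 by lra.
  by field; rewrite ?K1 ?K3 ?K1' ?K3'.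
rewrite j1 j2 -[n.+1%:R]natr1 {j1 j2 IH}.
have c1 := cc_neq0 nM; have n0 : 0 <= n%:R :> rat by [].
move: (cc n) (cc n.+1) c0 c1 (pre n) (alpha n) (M%:R : rat) (n%:R : rat) n0.
move=> c c' c0 c1 p a m k k0.
have K1 : 4 * k + 1 != 0 by lra.
have K3 : 4 * k + 3 != 0 by lra.
have K5 : 4 * k + 5 != 0 by lra.
have K0 : k + 1 != 0 by lra.
by field; rewrite ?c0 ?c1 ?K0 ?K1 ?K3 ?K5.
Qed.

(** By [preS], the recurrence [S_rec] multiplied by [pre n / cc n] says that [pre n * S n] increases
    by the left side of [termE]. *)
Let pre_S n : (n <= M)%N -> pre n * S n = \sum_(i < n) term i.*2.
Proof.
elim: n => [|n IH] nM; first by rewrite /S big_geq // mulr0 big_ord0.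
have c0 := cc_neq0 nM.
rewrite big_ord_recr /= -IH ?(ltnW nM) // -termE // -S_rec ?(ltnW nM) // preS //.
move: (cc n) c0 => c c0; by field.
Qed.

Let sum_even n : \sum_(j < n.*2.+1) term j = \sum_(i < n.+1) term i.*2.
Proof.
elim: n => [|n IH]; first by rewrite !big_ord1.
rewrite doubleS 2!big_ord_recr [RHS]big_ord_recr /= IH -addrA; congr (_ + _).
by rewrite {1}/term chebyshev_odd0 expr0n mul0r add0r.
Qed.

Lemma Q_sum_chebyshev_sub m n : (0 < n)%N -> M = (m + n)%N ->
  Q m n = \sum_(j < 2 * n - 1) (chebyshev N j).[0] ^+ 2 / sqnorm N j.
Proof.
case: n => // n _ eM.
transitivity (pre n.+1 * S n.+1).
  rewrite /Q /pre /S.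
  have -> : (M - n.+1 = m)%N by lia.
  have -> : (m + 2 * n.+1 - 1 = M + n.+1 - 1)%N by lia.
  have -> : (2 * m + 4 * n.+1 - 2 = 2 * M + 2 * n.+1 - 2)%N by lia.
  by rewrite -eM.
rewrite pre_S; last by lia.
rewrite -sum_even; have -> : (2 * n.+1 - 1 = n.*2.+1)%N by lia.
by [].
Qed.

End CenterDensity.

Lemma Q_sum_chebyshev (m n : nat) : (0 < n)%N ->
  Q m n = \sum_(j < 2 * n - 1) (chebyshev (2 * n - 1 + 2 * m) j).[0] ^+ 2 /
            sqnorm (2 * n - 1 + 2 * m) j.
Proof.
move=> n0; rewrite (@Q_sum_chebyshev_sub (m + n)) //; last by rewrite addn_gt0 n0 orbT.
by have -> : (2 * (m + n) - 1 = 2 * n - 1 + 2 * m)%N by lia.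
Qed.

Theorem theorem1 (m n : nat) (hn : (0 < n)%N) :
  (#|centered_tilings (2 * n - 1) (2 * n - 1) (2 * m)|%:R
   = Q m n * P (2 * n - 1) (2 * n - 1) (2 * m))%R.
Proof.
(* The middle one of the 2(m + n) - 1 edges of the diagonal, counted from 0. *)
have o_lt : ((m + n).-1 < 2 * n - 1 + 2 * m)%N by lia.
have oE : ((Ordinal o_lt).*2.+1 = 2 * n - 1 + 2 * m)%N by rewrite /=; lia.
have a_gt0 : (0 < 2 * n - 1)%N by lia.
by rewrite (card_centered_tilings_sqnorm a_gt0 oE) prod_sqnorm Q_sum_chebyshev // mulrC.
Qed.
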